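(* Let $X$ be a Noetherian scheme and $\mathcal F$ a non-zero coherent sheaf on $X$. Write $\mathrm{Ass}(\mathcal F)=\{\mathfrak{p}_1,\dots, \mathfrak{p}_n\}$ (with the $\mathfrak p_i$ distinct). Assume that $\overline{\{\mathfrak{p}_i\}}\cap \overline{\{\mathfrak{p}_j\}}=\emptyset$ for all $i,j\in \{1,\dots, n\}$ with $i\neq j$. For $j\in\{1,\dots,n\}$ let $t_j:\mathrm{Spec}(\mathcal O_{X,\mathfrak{p}_j})\rightarrow X$ be the canonical morphism, and for $i\in\{1,\dots,n\}$ let $$\mathcal F_i=\bigcap_{j\neq i}\ker(\mathcal F\rightarrow t_{j*}t_j^*\mathcal F).$$ Then $\mathrm{Ass}(\mathcal F_i)=\{\mathfrak{p}_i\}$ for every $i$. Moreover, $$\mathcal F=\bigoplus_{1\leqslant i\leqslant n} \mathcal F_i.$$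
   Context: For a quasi-coherent sheaf $\mathcal F$ on a locally Noetherian scheme $X$, $\mathrm{Ass}(\mathcal F)$ is the set of points $x\in X$ such that there is $s_x\in\mathcal F_x$ with $\mathrm{ann}(s_x)=\mathfrak m_x$, the maximal ideal of $\mathcal O_{X,x}$. The maps $\mathcal F\to t_{j*}t_j^*\mathcal F$ are the adjunction units. The intersection $\bigcap_{j\in J}\mathcal H_j$ of a family of $\mathcal O_X$-submodules of $\mathcal F$ is the kernel of $\mathcal F\to\prod_{j\in J}\mathcal F/\mathcal H_j$ (so it is $\mathcal F$ when $J=\emptyset$). The direct sum is internal: $\mathcal F$ is the direct sum of its subsheaves $\mathcal F_i$. *)

(* Defs.v *)
From HB Require Import structures.
From mathcomp Require Import all_boot all_order all_algebra ring.
From mathcomp Require Import generic_quotient.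
From mathcomp Require Import boolp classical_sets topology.

Set Implicit Arguments.
Unset Strict Implicit.
Unset Printing Implicit Defensive.

Import GRing.Theory.
Local Open Scope classical_set_scope.
Local Open Scope ring_scope.

Section ClassicalQuotient.
Local Open Scope quotient_scope.
Variables (T : Type) (e : T -> T -> Prop) (eE : RelationClasses.Equivalence e).

Let eb : rel {classic T} := fun x y => `[< e x y >].

Lemma cquot_equiv : equiv_class_of eb.
Proof.
case: eE => er es et; split.
- by move=> x; apply/asboolP; exact: er.
- by move=> x y; apply/asboolP/asboolP; exact: es.
- by move=> y x z /asboolP xy /asboolP yz; apply/asboolP; exact: et xy yz.
Qed.

Definition cquot_rel : equiv_rel {classic T} := EquivRelPack cquot_equiv.

Definition cquot : Type := {eq_quot cquot_rel}.

HB.instance Definition _ := Choice.on cquot.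

Definition cclass (x : T) : cquot := \pi_({eq_quot cquot_rel}) (x : {classic T}).

Definition crepr (z : cquot) : T := repr (z : {eq_quot cquot_rel}).

Lemma creprK z : cclass (crepr z) = z.
Proof. exact: reprK. Qed.

Lemma cclassP x y : cclass x = cclass y <-> e x y.
Proof.
split=> [/eqquotP/asboolP //|exy].
by apply/eqquotP/asboolP.
Qed.

Lemma crepr_class x : e (crepr (cclass x)) x.
Proof. by apply/cclassP; rewrite creprK. Qed.

End ClassicalQuotient.

(* [comPzRingType] allows the zero ring, as is needed for sections over the
   empty set. *)

Section Ideals.
Variable R : comPzRingType.
Implicit Types I : set R.

Definition is_ideal I :=
  [/\ I 0, forall a b, I a -> I b -> I (a + b) & forall r a, I a -> I (r * a)].

Definition prime_ideal I :=
  [/\ is_ideal I, ~ I 1 & forall a b, I (a * b) -> I a \/ I b].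

Definition maximal_ideal I :=
  [/\ is_ideal I, ~ I 1 &
      forall J, is_ideal J -> ~ J 1 -> I `<=` J -> J = I].

Definition local_ring := exists! I, maximal_ideal I.

Definition max_ideal (h : local_ring) : set R := sval (cid h).

Definition ideal_gen (l : seq R) : set R :=
  [set a | forall I, is_ideal I -> (forall b, b \in l -> I b) -> I a].

Definition noetherian_ring := forall I, is_ideal I -> exists l, I = ideal_gen l.

End Ideals.

Definition annihilator (R : comPzRingType) (M : lmodType R) (m : M) : set R :=
  [set a | a *: m = 0].

Record spec (R : comPzRingType) := Spec {
  prime_set :> R -> Prop;
  specP : prime_ideal prime_set
}.

Lemma spec_eq (R : comPzRingType) (p q : spec R) :
  (forall a, p a <-> q a) -> p = q.
Proof.
case: p q => [p Pp] [q Pq] /= pq.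
have {}pq : p = q by apply/funext => a; apply/propext.
by case: _ / pq in Pq *; rewrite (Prop_irrelevance Pp Pq).
Qed.

Lemma spec_n1 (R : comPzRingType) (q : spec R) : ~ q 1.
Proof. by case: (specP q). Qed.

Lemma spec_nM (R : comPzRingType) (q : spec R) a b : ~ q a -> ~ q b -> ~ q (a * b).
Proof. by case: (specP q) => _ _ h na nb /h[]. Qed.

Section Localization.
Variables (R : comPzRingType) (q : spec R).

Record pfrac := PFrac { pnum : R; pden : R; pden_nq : ~ q pden }.

Definition pfrac_rel (f g : pfrac) :=
  exists2 u, ~ q u & u * (pnum f * pden g) = u * (pnum g * pden f).

Lemma pfrac_equiv : RelationClasses.Equivalence pfrac_rel.
Proof.
split.
- by move=> f; exists 1 => //; exact: spec_n1.
- by move=> f g [u nu e]; exists u.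
- move=> f g h [u nu e1] [v nv e2]; exists (u * v * pden g).
    exact: (spec_nM (spec_nM nu nv) (@pden_nq g)).
  transitivity (v * pden h * (u * (pnum f * pden g))); first ring.
  rewrite e1; transitivity (u * pden f * (v * (pnum g * pden h))); first ring.
  rewrite e2; ring.
Qed.

Definition loc : Type := cquot pfrac_equiv.

HB.instance Definition _ := Choice.on loc.

Definition frac (a b : R) (hb : ~ q b) : loc := cclass pfrac_equiv (PFrac a hb).

Lemma fracP a b (hb : ~ q b) c d (hd : ~ q d) :
  frac a hb = frac c hd <-> exists2 u, ~ q u & u * (a * d) = u * (c * b).
Proof. exact: cclassP. Qed.

Lemma frac_ex (z : loc) : exists a b (hb : ~ q b), z = frac a hb.
Proof.
rewrite -[z]creprK; case: (crepr z) => a b hb.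
by exists a, b, hb.
Qed.

Let num (z : loc) := pnum (crepr z).
Let den (z : loc) := pden (crepr z).
Let den_nq (z : loc) : ~ q (den z). Proof. exact: pden_nq. Qed.

Let numden a b (hb : ~ q b) :
  exists2 u, ~ q u & u * (num (frac a hb) * b) = u * (a * den (frac a hb)).
Proof. exact: (crepr_class pfrac_equiv (PFrac a hb)). Qed.

Definition loc_zero : loc := frac 0 (@spec_n1 R q).
Definition loc_one : loc := frac 1 (@spec_n1 R q).
Definition loc_opp (z : loc) : loc := frac (- num z) (@den_nq z).
Definition loc_add (z w : loc) : loc :=
  frac (num z * den w + num w * den z) (spec_nM (@den_nq z) (@den_nq w)).
Definition loc_mul (z w : loc) : loc :=
  frac (num z * num w) (spec_nM (@den_nq z) (@den_nq w)).

Lemma loc_oppE a b (hb : ~ q b) : loc_opp (frac a hb) = frac (- a) hb.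
Proof.
apply/fracP; have [u nu e] := numden a hb; exists u => //.
by rewrite !mulNr !mulrN e.
Qed.

Lemma loc_addE a b (hb : ~ q b) c d (hd : ~ q d) :
  loc_add (frac a hb) (frac c hd) = frac (a * d + c * b) (spec_nM hb hd).
Proof.
apply/fracP; have [u nu e] := numden a hb; have [v nv f] := numden c hd.
exists (u * v); first exact: spec_nM.
set n1 := num _ in e *; set n2 := num (frac c hd) in f *.
set d1 := den _ in e *; set d2 := den (frac c hd) in f *.
transitivity (v * d * d2 * (u * (n1 * b)) + u * b * d1 * (v * (n2 * d))).
  by ring.
by rewrite e f; ring.
Qed.

Lemma loc_mulE a b (hb : ~ q b) c d (hd : ~ q d) :
  loc_mul (frac a hb) (frac c hd) = frac (a * c) (spec_nM hb hd).
Proof.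
apply/fracP; have [u nu e] := numden a hb; have [v nv f] := numden c hd.
exists (u * v); first exact: spec_nM.
set n1 := num _ in e *; set n2 := num (frac c hd) in f *.
set d1 := den _ in e *; set d2 := den (frac c hd) in f *.
transitivity ((u * (n1 * b)) * (v * (n2 * d))); first by ring.
by rewrite e f; ring.
Qed.

Lemma frac_eq a b (hb : ~ q b) c d (hd : ~ q d) :
  a * d = c * b -> frac a hb = frac c hd.
Proof. by move=> e; apply/fracP; exists 1; [exact: spec_n1|rewrite e]. Qed.

Lemma loc_addA : associative loc_add.
Proof.
move=> x y z; have [a [b [hb ->]]] := frac_ex x.
have [c [d [hd ->]]] := frac_ex y; have [f [g [hg ->]]] := frac_ex z.
by rewrite !loc_addE; apply: frac_eq; ring.
Qed.

Lemma loc_addC : commutative loc_add.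
Proof.
move=> x y; have [a [b [hb ->]]] := frac_ex x.
have [c [d [hd ->]]] := frac_ex y.
by rewrite !loc_addE; apply: frac_eq; ring.
Qed.

Lemma loc_add0 : left_id loc_zero loc_add.
Proof.
move=> x; have [a [b [hb ->]]] := frac_ex x.
by rewrite !loc_addE; apply: frac_eq; ring.
Qed.

Lemma loc_addN : left_inverse loc_zero loc_opp loc_add.
Proof.
move=> x; have [a [b [hb ->]]] := frac_ex x.
by rewrite loc_oppE !loc_addE; apply: frac_eq; ring.
Qed.

Lemma loc_mulA : associative loc_mul.
Proof.
move=> x y z; have [a [b [hb ->]]] := frac_ex x.
have [c [d [hd ->]]] := frac_ex y; have [f [g [hg ->]]] := frac_ex z.
by rewrite !loc_mulE; apply: frac_eq; ring.
Qed.

Lemma loc_mulC : commutative loc_mul.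
Proof.
move=> x y; have [a [b [hb ->]]] := frac_ex x.
have [c [d [hd ->]]] := frac_ex y.
by rewrite !loc_mulE; apply: frac_eq; ring.
Qed.

Lemma loc_mul1 : left_id loc_one loc_mul.
Proof.
move=> x; have [a [b [hb ->]]] := frac_ex x.
by rewrite !loc_mulE; apply: frac_eq; ring.
Qed.

Lemma loc_mulD : left_distributive loc_mul loc_add.
Proof.
move=> x y z; have [a [b [hb ->]]] := frac_ex x.
have [c [d [hd ->]]] := frac_ex y; have [f [g [hg ->]]] := frac_ex z.
by rewrite !(loc_mulE, loc_addE); apply: frac_eq; ring.
Qed.

HB.instance Definition _ :=
  GRing.isZmodule.Build loc loc_addA loc_addC loc_add0 loc_addN.
HB.instance Definition _ :=
  GRing.Zmodule_isComPzRing.Build loc loc_mulA loc_mulC loc_mul1 loc_mulD.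

Lemma frac_add a b (hb : ~ q b) c d (hd : ~ q d) :
  frac a hb + frac c hd = frac (a * d + c * b) (spec_nM hb hd).
Proof. exact: loc_addE. Qed.

Lemma frac_mul a b (hb : ~ q b) c d (hd : ~ q d) :
  frac a hb * frac c hd = frac (a * c) (spec_nM hb hd).
Proof. exact: loc_mulE. Qed.

Lemma frac_opp a b (hb : ~ q b) : - frac a hb = frac (- a) hb.
Proof. exact: loc_oppE. Qed.

Lemma frac0 : 0 = frac 0 (@spec_n1 R q) :> loc. Proof. by []. Qed.
Lemma frac1 : 1 = frac 1 (@spec_n1 R q) :> loc. Proof. by []. Qed.

End Localization.

Section SpecMap.
Variables (R S : comPzRingType) (phi : {rmorphism R -> S}).

Lemma spec_comap_prime (q : spec S) : prime_ideal (phi @^-1` q).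
Proof.
case: (specP q) => -[q0 qD qM] n1 qp; split; first split => //=.
- by rewrite rmorph0.
- by move=> a b qa qb; rewrite rmorphD; exact: qD.
- by move=> r a qa; rewrite rmorphM; exact: qM.
- by rewrite /= rmorph1.
- by move=> a b /=; rewrite rmorphM; exact: qp.
Qed.

Definition spec_comap (q : spec S) : spec R := Spec (spec_comap_prime q).

Variable q : spec S.

(* R_{phi^-1 q} -> S_q, sending a / b to phi a / phi b. *)
Definition loc_map (z : loc (spec_comap q)) : loc q :=
  let f := crepr z in @frac S q (phi (pnum f)) (phi (pden f)) (@pden_nq _ _ f).

Lemma loc_mapE a b (hb : ~ spec_comap q b) :
  loc_map (frac a hb) = @frac S q (phi a) (phi b) hb.
Proof.
apply/fracP; have [u nu /= e] := crepr_class (pfrac_equiv (spec_comap q)) (PFrac a hb).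
by exists (phi u) => //; rewrite -!rmorphM e.
Qed.

Lemma loc_map_zmod : zmod_morphism loc_map.
Proof.
move=> x y; have [a [b [hb ->]]] := frac_ex x.
have [c [d [hd ->]]] := frac_ex y.
rewrite frac_opp frac_add !loc_mapE frac_opp frac_add; apply: frac_eq.
by rewrite !(rmorphM, rmorphD, rmorphN).
Qed.

Lemma loc_map_monoid : monoid_morphism loc_map.
Proof.
split=> [|x y]; first by rewrite frac1 loc_mapE; apply: frac_eq; rewrite !rmorph1.
have [a [b [hb ->]]] := frac_ex x; have [c [d [hd ->]]] := frac_ex y.
by rewrite frac_mul !loc_mapE frac_mul; apply: frac_eq; rewrite !rmorphM.
Qed.

HB.instance Definition _ := GRing.isZmodMorphism.Build _ _ loc_map loc_map_zmod.
HB.instance Definition _ := GRing.isMonoidMorphism.Build _ _ loc_map loc_map_monoid.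

End SpecMap.

(* The B-module M (x)_A B, as the quotient of the formal sums of pure tensors
   m (x) b by the relation "every A-balanced biadditive map takes the same
   value on both", which is the congruence defining the tensor product. *)

Section BaseChange.
Variables (A B : comPzRingType) (phi : {rmorphism A -> B}) (M : lmodType A).

Definition balanced (N : zmodType) (f : M -> B -> N) :=
  [/\ forall m m' b, f (m + m') b = f m b + f m' b,
      forall m b b', f m (b + b') = f m b + f m b' &
      forall a m b, f (a *: m) b = f m (phi a * b)].

Definition tens_eval (N : zmodType) (f : M -> B -> N) (l : seq (M * B)) : N :=
  \sum_(t <- l) f t.1 t.2.

Definition tens_rel (l l' : seq (M * B)) := forall (N : zmodType) (f : M -> B -> N),
  balanced f -> tens_eval f l = tens_eval f l'.

Lemma tens_equiv : RelationClasses.Equivalence tens_rel.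
Proof.
split=> [l N f fb//|l l' e N f fb|l l' l'' e e' N f fb].
  by rewrite (e N f fb).
by rewrite (e N f fb) (e' N f fb).
Qed.

Definition base_change : Type := cquot tens_equiv.

HB.instance Definition _ := Choice.on base_change.

Let cls : seq (M * B) -> base_change := cclass tens_equiv.

Lemma tens_ex (z : base_change) : exists l, z = cls l.
Proof. by exists (crepr z); rewrite /cls creprK. Qed.

Lemma tens_evalD (N : zmodType) (f : M -> B -> N) l l' :
  tens_eval f (l ++ l') = tens_eval f l + tens_eval f l'.
Proof. by rewrite /tens_eval big_cat. Qed.

Definition tens_zero : base_change := cls [::].
Definition tens_opp (z : base_change) : base_change :=
  cls [seq (- t.1, t.2) | t <- crepr z].
Definition tens_add (z w : base_change) : base_change := cls (crepr z ++ crepr w).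
Definition tens_scale (b : B) (z : base_change) : base_change :=
  cls [seq (t.1, b * t.2) | t <- crepr z].

Lemma tens_evalN (N : zmodType) (f : M -> B -> N) l : balanced f ->
  tens_eval f [seq (- t.1, t.2) | t <- l] = - tens_eval f l.
Proof.
move=> [fD _ _]; rewrite /tens_eval big_map -sumrN; apply: eq_bigr => t _ /=.
have f0 b : f 0 b = 0 by apply: (addrI (f 0 b)); rewrite -fD !addr0.
by apply/eqP; rewrite -addr_eq0 -fD addNr f0.
Qed.

Lemma balancedZ (N : zmodType) (f : M -> B -> N) b : balanced f ->
  balanced (fun m c => f m (b * c)).
Proof.
move=> [fD fD' fZ]; split=> *; first exact: fD.
  by rewrite mulrDr fD'.
by rewrite fZ mulrCA.
Qed.

Lemma tens_evalZ (N : zmodType) (f : M -> B -> N) b l :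
  tens_eval f [seq (t.1, b * t.2) | t <- l] = tens_eval (fun m c => f m (b * c)) l.
Proof. by rewrite /tens_eval big_map. Qed.

Lemma tens_oppE l : tens_opp (cls l) = cls [seq (- t.1, t.2) | t <- l].
Proof.
apply/cclassP => N f fb; rewrite !tens_evalN//.
by rewrite (crepr_class tens_equiv l N f fb).
Qed.

Lemma tens_addE l l' : tens_add (cls l) (cls l') = cls (l ++ l').
Proof.
apply/cclassP => N f fb; rewrite !tens_evalD.
by rewrite (crepr_class tens_equiv l N f fb) (crepr_class tens_equiv l' N f fb).
Qed.

Lemma tens_scaleE b l :
  tens_scale b (cls l) = cls [seq (t.1, b * t.2) | t <- l].
Proof.
apply/cclassP => N f fb; rewrite !tens_evalZ.
by rewrite (crepr_class tens_equiv l N _ (balancedZ b fb)).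
Qed.

Lemma tens_addA : associative tens_add.
Proof.
move=> x y z; have [l ->] := tens_ex x; have [l' ->] := tens_ex y.
by have [l'' ->] := tens_ex z; rewrite !tens_addE catA.
Qed.

Lemma tens_addC : commutative tens_add.
Proof.
move=> x y; have [l ->] := tens_ex x; have [l' ->] := tens_ex y.
by rewrite !tens_addE; apply/cclassP => N f fb; rewrite !tens_evalD addrC.
Qed.

Lemma tens_add0 : left_id tens_zero tens_add.
Proof. by move=> x; have [l ->] := tens_ex x; rewrite tens_addE. Qed.

Lemma tens_addN : left_inverse tens_zero tens_opp tens_add.
Proof.
move=> x; have [l ->] := tens_ex x; rewrite tens_oppE tens_addE.
apply/cclassP => N f fb; rewrite tens_evalD tens_evalN// addNr.
by rewrite /tens_eval big_nil.
Qed.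

HB.instance Definition _ :=
  GRing.isZmodule.Build base_change tens_addA tens_addC tens_add0 tens_addN.

Lemma cls_add l l' : cls l + cls l' = cls (l ++ l').
Proof. exact: tens_addE. Qed.

Lemma tens_scaleA a b z : tens_scale a (tens_scale b z) = tens_scale (a * b) z.
Proof.
have [l ->] := tens_ex z; rewrite !tens_scaleE -map_comp.
by congr (cls _); apply: eq_map => t /=; rewrite mulrA.
Qed.

Lemma tens_scale1 : left_id 1 tens_scale.
Proof.
move=> z; have [l ->] := tens_ex z; rewrite tens_scaleE.
by congr (cls _); rewrite -[RHS]map_id; apply: eq_map => -[m b] /=; rewrite mul1r.
Qed.

Lemma tens_scaleDr : right_distributive tens_scale +%R.
Proof.
move=> b x y; have [l ->] := tens_ex x; have [l' ->] := tens_ex y.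
by rewrite cls_add !tens_scaleE cls_add map_cat.
Qed.

Lemma tens_scaleDl z : {morph tens_scale^~ z : a b / a + b}.
Proof.
move=> a b; have [l ->] := tens_ex z; rewrite !tens_scaleE cls_add.
apply/cclassP => N f fb; case: (fb) => _ fD _.
rewrite tens_evalD !tens_evalZ /tens_eval -big_split /=.
by apply: eq_bigr => t _; rewrite mulrDl fD.
Qed.

HB.instance Definition _ := GRing.Zmodule_isLmodule.Build B base_change
  tens_scaleA tens_scale1 tens_scaleDr tens_scaleDl.

Definition pure_tensor (m : M) (b : B) : base_change := cls [:: (m, b)].

Lemma tens_cls_sum l : cls l = \sum_(t <- l) pure_tensor t.1 t.2.
Proof.
elim: l => [|[m b] l IH]; first by rewrite big_nil.
by rewrite big_cons -IH cls_add.
Qed.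

Lemma pure_tensor_balanced : balanced pure_tensor.
Proof.
split=> [m m' b|m b b'|a m b].
- rewrite /pure_tensor cls_add; apply/cclassP => N f [fD _ _].
  by rewrite /tens_eval !(big_cons, big_nil) /= !addr0.
- rewrite /pure_tensor cls_add; apply/cclassP => N f [_ fD _].
  by rewrite /tens_eval !(big_cons, big_nil) /= !addr0.
- apply/cclassP => N f [_ _ fZ].
  by rewrite /tens_eval !(big_cons, big_nil) /= !addr0.
Qed.

Lemma pure_tensorDl m m' b : pure_tensor (m + m') b = pure_tensor m b + pure_tensor m' b.
Proof. by case: pure_tensor_balanced => h _ _; exact: h. Qed.

Lemma pure_tensorDr m b b' : pure_tensor m (b + b') = pure_tensor m b + pure_tensor m b'.
Proof. by case: pure_tensor_balanced => _ h _; exact: h. Qed.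

Lemma pure_tensorZl a m b : pure_tensor (a *: m) b = pure_tensor m (phi a * b).
Proof. by case: pure_tensor_balanced => _ _ h; exact: h. Qed.

Lemma pure_tensorZ b m c : b *: pure_tensor m c = pure_tensor m (b * c).
Proof. by transitivity (tens_scale b (cls [:: (m, c)])) => //; rewrite tens_scaleE. Qed.

End BaseChange.

Arguments pure_tensor {A B} phi {M} m b.

Definition restrict_scalars (A B : comPzRingType) (phi : {rmorphism A -> B})
  (M : lmodType B) : Type := M.

Section RestrictScalars.
Variables (A B : comPzRingType) (phi : {rmorphism A -> B}) (M : lmodType B).

HB.instance Definition _ := GRing.Zmodule.copy (restrict_scalars phi M) M.

Local Notation restrict_scalars := (restrict_scalars phi M).

Let rs_scale (a : A) (m : restrict_scalars) : restrict_scalars := phi a *: (m : M).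

Let rs_scaleA a b m : rs_scale a (rs_scale b m) = rs_scale (a * b) m.
Proof. by rewrite /rs_scale scalerA rmorphM. Qed.
Let rs_scale1 : left_id 1 rs_scale.
Proof. by move=> m; rewrite /rs_scale rmorph1 scale1r. Qed.
Let rs_scaleDr : right_distributive rs_scale +%R.
Proof. by move=> a m m'; rewrite /rs_scale scalerDr. Qed.
Let rs_scaleDl m : {morph rs_scale^~ m : a b / a + b}.
Proof. by move=> a b; rewrite /rs_scale rmorphD scalerDl. Qed.

HB.instance Definition _ := GRing.Zmodule_isLmodule.Build A restrict_scalars
  rs_scaleA rs_scale1 rs_scaleDr rs_scaleDl.

End RestrictScalars.

Record opens (X : topologicalType) := Opens {
  opens_set :> X -> Prop;
  opensP : open (opens_set : set X)
}.

Section Opens.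
Variable X : topologicalType.

Definition opensT : opens X := Opens openT.
Definition opensI (U V : opens X) : opens X := Opens (openI (opensP U) (opensP V)).

Lemma opensIl U V : opensI U V `<=` U. Proof. by move=> x []. Qed.
Lemma opensIr U V : opensI U V `<=` V. Proof. by move=> x []. Qed.

Variables (Y : topologicalType) (f : Y -> X) (fc : continuous f).

Lemma opens_preimP (U : opens X) : open (f @^-1` U).
Proof. by move: fc => /continuousP; apply; exact: opensP. Qed.

Definition opens_preim (U : opens X) : opens Y := Opens (opens_preimP U).

End Opens.

Record is_sheaf (X : topologicalType) (S : opens X -> Type)
    (res : forall U V : opens X, V `<=` U -> S U -> S V) : Prop := IsSheaf {
  sheaf_id : forall (U : opens X) (h : U `<=` U) s, res U U h s = s;
  sheaf_comp : forall (U V W : opens X) (hVU : V `<=` U) (hWV : W `<=` V) (hWU : W `<=` U) s,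
    res V W hWV (res U V hVU s) = res U W hWU s;
  sheaf_sep : forall (U : opens X) s t,
    (forall x, U x -> exists (V : opens X) (hV : V `<=` U), V x /\ res U V hV s = res U V hV t) ->
    s = t;
  sheaf_glue : forall (U : opens X) (I : Type) (V : I -> opens X) (hV : forall i, V i `<=` U)
      (s : forall i, S (V i)),
    (forall x, U x -> exists i, V i x) ->
    (forall i j (W : opens X) (hi : W `<=` V i) (hj : W `<=` V j),
      res (V i) W hi (s i) = res (V j) W hj (s j)) ->
    exists t, forall i, res U (V i) (hV i) t = s i
}.

Section Stalk.
Variables (X : topologicalType) (S : opens X -> Type).
Variables (res : forall U V : opens X, V `<=` U -> S U -> S V).
Hypothesis shS : is_sheaf res.
Variable x : X.

Record pgerm := PGerm { pgerm_open : opens X; pgerm_mem : pgerm_open x;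
  pgerm_sec : S pgerm_open }.

Definition pgerm_rel (g h : pgerm) :=
  exists (W : opens X) (hg : W `<=` pgerm_open g) (hh : W `<=` pgerm_open h),
    W x /\ res hg (pgerm_sec g) = res hh (pgerm_sec h).

Lemma pgerm_equiv : RelationClasses.Equivalence pgerm_rel.
Proof.
split.
- by move=> [U Ux s]; exists U, (@subset_refl _ _), (@subset_refl _ _).
- by move=> g h [W [hg [hh [Wx e]]]]; exists W, hh, hg.
- move=> g h k [W [hg [hh [Wx e]]]] [W' [hh' [hk [W'x e']]]].
  have hW := @opensIl X W W'; have hW' := @opensIr X W W'.
  exists (opensI W W'), (subset_trans hW hg), (subset_trans hW' hk); split => //.
  rewrite -(sheaf_comp shS hg hW) e -(sheaf_comp shS hk hW') -e'.
  by rewrite (sheaf_comp shS _ _ (subset_trans hW hh))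
             (sheaf_comp shS _ _ (subset_trans hW hh)).
Qed.

Definition stalk : Type := cquot pgerm_equiv.

HB.instance Definition _ := Choice.on stalk.

Definition germ (U : opens X) (Ux : U x) (s : S U) : stalk :=
  cclass pgerm_equiv (PGerm Ux s).

Lemma germP (U : opens X) (Ux : U x) s (V : opens X) (Vx : V x) t :
  germ Ux s = germ Vx t <->
  exists (W : opens X) (hU : W `<=` U) (hV : W `<=` V), W x /\ res hU s = res hV t.
Proof. exact: cclassP. Qed.

Lemma germ_res (U V : opens X) (h : V `<=` U) (Ux : U x) (Vx : V x) s :
  germ Vx (res h s) = germ Ux s.
Proof.
apply/germP; exists V, (@subset_refl _ _), h; split => //.
exact: (sheaf_comp shS).
Qed.

Lemma germ_ex (z : stalk) : exists (U : opens X) (Ux : U x) s, z = germ Ux s.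
Proof.
rewrite -[z]creprK; case: (crepr z) => U Ux s.
by exists U, Ux, s.
Qed.

Lemma germ_ex2 (z w : stalk) : exists (U : opens X) (Ux : U x) s t,
  z = germ Ux s /\ w = germ Ux t.
Proof.
have [U [Ux [s ->]]] := germ_ex z; have [V [Vx [t ->]]] := germ_ex w.
exists (opensI U V), (conj Ux Vx), (res (@opensIl X U V) s), (res (@opensIr X U V) t).
by rewrite !germ_res.
Qed.

Lemma germ_ex3 (z w v : stalk) : exists (U : opens X) (Ux : U x) s t r,
  [/\ z = germ Ux s, w = germ Ux t & v = germ Ux r].
Proof.
have [U [Ux [s [t [-> ->]]]]] := germ_ex2 z w; have [V [Vx [r ->]]] := germ_ex v.
exists (opensI U V), (conj Ux Vx), (res (@opensIl X U V) s),
  (res (@opensIl X U V) t), (res (@opensIr X U V) r).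
by rewrite !germ_res.
Qed.

Definition stalk_map1 (f : forall U, S U -> S U) (z : stalk) : stalk :=
  germ (pgerm_mem (crepr z)) (f _ (pgerm_sec (crepr z))).

Definition stalk_map2 (f : forall U, S U -> S U -> S U) (z w : stalk) : stalk :=
  let U := pgerm_open (crepr z) in let V := pgerm_open (crepr w) in
  germ (conj (pgerm_mem (crepr z)) (pgerm_mem (crepr w)) : opensI U V x)
    (f _ (res (@opensIl X U V) (pgerm_sec (crepr z)))
         (res (@opensIr X U V) (pgerm_sec (crepr w)))).

Lemma stalk_map1E (f : forall U, S U -> S U)
    (fres : forall (U V : opens X) (h : V `<=` U) s, res h (f U s) = f V (res h s))
    (U : opens X) (Ux : U x) s :
  stalk_map1 f (germ Ux s) = germ Ux (f U s).
Proof.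
have [W [h1 [h2 [Wx /= e]]]] := crepr_class pgerm_equiv (PGerm Ux s).
apply/germP; exists W, h1, h2; split => //.
by rewrite !fres e.
Qed.

Lemma stalk_map2E (f : forall U, S U -> S U -> S U)
    (fres : forall (U V : opens X) (h : V `<=` U) s t, res h (f U s t) = f V (res h s) (res h t))
    (U : opens X) (Ux : U x) s t :
  stalk_map2 f (germ Ux s) (germ Ux t) = germ Ux (f U s t).
Proof.
have [W [h1 [h2 [Wx /= e]]]] := crepr_class pgerm_equiv (PGerm Ux s).
have [W' [h1' [h2' [W'x /= e']]]] := crepr_class pgerm_equiv (PGerm Ux t).
have hW := @opensIl X W W'; have hW' := @opensIr X W W'.
have k1 := subset_trans hW h1; have k2 := subset_trans hW h2.
have k1' := subset_trans hW' h1'.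
have k : opensI W W' `<=` opensI _ _ :=
  fun y hy => conj (h1 y (proj1 hy)) (h1' y (proj2 hy)).
apply/germP; exists (opensI W W'), k, k2; split => //.
rewrite !fres (sheaf_comp shS _ _ k1) (sheaf_comp shS _ _ k1').
rewrite -(sheaf_comp shS h1 hW k1) -(sheaf_comp shS h1' hW' k1') e e'.
by rewrite !(sheaf_comp shS _ _ k2).
Qed.

End Stalk.

Record ringSheaf (X : topologicalType) := RingSheaf {
  rsec :> opens X -> comPzRingType;
  rres : forall U V : opens X, V `<=` U -> {rmorphism rsec U -> rsec V};
  ringSheafP : is_sheaf rres
}.

Section RingStalk.
Variables (X : topologicalType) (O : ringSheaf X) (x : X).

Definition rstalk : Type := stalk (ringSheafP O) x.

HB.instance Definition _ := Choice.on rstalk.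

Definition rgerm (U : opens X) (Ux : U x) (a : O U) : rstalk :=
  germ (ringSheafP O) Ux a.

Let st1 (f : forall U, O U -> O U) : rstalk -> rstalk := @stalk_map1 _ _ _ _ _ f.
Let st2 (f : forall U, O U -> O U -> O U) : rstalk -> rstalk -> rstalk :=
  @stalk_map2 _ _ _ _ _ f.

Definition rstalk_zero : rstalk := @rgerm (opensT X) I 0.
Definition rstalk_one : rstalk := @rgerm (opensT X) I 1.
Definition rstalk_opp : rstalk -> rstalk := st1 (fun U => -%R).
Definition rstalk_add : rstalk -> rstalk -> rstalk := st2 (fun U => +%R).
Definition rstalk_mul : rstalk -> rstalk -> rstalk := st2 (fun U => *%R).

Lemma rstalk_zeroE (U : opens X) (Ux : U x) : rstalk_zero = rgerm Ux 0.
Proof.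
have h : U `<=` opensT X by [].
by rewrite /rgerm -(rmorph0 (rres O h)) (germ_res _ h I).
Qed.

Lemma rstalk_oneE (U : opens X) (Ux : U x) : rstalk_one = rgerm Ux 1.
Proof.
have h : U `<=` opensT X by [].
by rewrite /rgerm -(rmorph1 (rres O h)) (germ_res _ h I).
Qed.

Lemma rstalk_oppE (U : opens X) (Ux : U x) a : rstalk_opp (rgerm Ux a) = rgerm Ux (- a).
Proof. by apply: stalk_map1E => *; rewrite rmorphN. Qed.

Lemma rstalk_addE (U : opens X) (Ux : U x) a b :
  rstalk_add (rgerm Ux a) (rgerm Ux b) = rgerm Ux (a + b).
Proof. by apply: stalk_map2E => *; rewrite rmorphD. Qed.

Lemma rstalk_mulE (U : opens X) (Ux : U x) a b :
  rstalk_mul (rgerm Ux a) (rgerm Ux b) = rgerm Ux (a * b).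
Proof. by apply: stalk_map2E => *; rewrite rmorphM. Qed.

Lemma rstalk_addA : associative rstalk_add.
Proof.
move=> z w v; have [U [Ux [a [b [c [-> -> ->]]]]]] := germ_ex3 z w v.
by rewrite !rstalk_addE addrA.
Qed.

Lemma rstalk_addC : commutative rstalk_add.
Proof.
move=> z w; have [U [Ux [a [b [-> ->]]]]] := germ_ex2 z w.
by rewrite !rstalk_addE addrC.
Qed.

Lemma rstalk_add0 : left_id rstalk_zero rstalk_add.
Proof.
move=> z; have [U [Ux [a ->]]] := germ_ex z.
by rewrite (rstalk_zeroE Ux) rstalk_addE add0r.
Qed.

Lemma rstalk_addN : left_inverse rstalk_zero rstalk_opp rstalk_add.
Proof.
move=> z; have [U [Ux [a ->]]] := germ_ex z.
by rewrite (rstalk_zeroE Ux) rstalk_oppE rstalk_addE addNr.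
Qed.

Lemma rstalk_mulA : associative rstalk_mul.
Proof.
move=> z w v; have [U [Ux [a [b [c [-> -> ->]]]]]] := germ_ex3 z w v.
by rewrite !rstalk_mulE mulrA.
Qed.

Lemma rstalk_mulC : commutative rstalk_mul.
Proof.
move=> z w; have [U [Ux [a [b [-> ->]]]]] := germ_ex2 z w.
by rewrite !rstalk_mulE mulrC.
Qed.

Lemma rstalk_mul1 : left_id rstalk_one rstalk_mul.
Proof.
move=> z; have [U [Ux [a ->]]] := germ_ex z.
by rewrite (rstalk_oneE Ux) rstalk_mulE mul1r.
Qed.

Lemma rstalk_mulD : left_distributive rstalk_mul rstalk_add.
Proof.
move=> z w v; have [U [Ux [a [b [c [-> -> ->]]]]]] := germ_ex3 z w v.
by rewrite !(rstalk_addE, rstalk_mulE) mulrDl.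
Qed.

HB.instance Definition _ := GRing.isZmodule.Build rstalk
  rstalk_addA rstalk_addC rstalk_add0 rstalk_addN.
HB.instance Definition _ := GRing.Zmodule_isComPzRing.Build rstalk
  rstalk_mulA rstalk_mulC rstalk_mul1 rstalk_mulD.

Section Germ.
Variables (U : opens X) (Ux : U x).

Lemma rgerm_zmod : zmod_morphism (rgerm Ux).
Proof. by move=> a b; rewrite -rstalk_addE -rstalk_oppE. Qed.

Lemma rgerm_monoid : monoid_morphism (rgerm Ux).
Proof. by split=> [|a b]; [rewrite -(rstalk_oneE Ux)|rewrite -rstalk_mulE]. Qed.

HB.instance Definition _ := GRing.isZmodMorphism.Build _ _ (rgerm Ux) rgerm_zmod.
HB.instance Definition _ := GRing.isMonoidMorphism.Build _ _ (rgerm Ux) rgerm_monoid.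

End Germ.

Lemma rgerm_res (U V : opens X) (h : V `<=` U) (Ux : U x) (Vx : V x) a :
  rgerm Vx (rres O h a) = rgerm Ux a.
Proof. exact: germ_res. Qed.

Lemma rgerm_ex (z : rstalk) : exists (U : opens X) (Ux : U x) a, z = rgerm Ux a.
Proof. exact: germ_ex. Qed.

End RingStalk.

Record modSheaf (X : topologicalType) (O : ringSheaf X) := ModSheaf {
  msec :> forall U : opens X, lmodType (O U);
  mres : forall U V : opens X, V `<=` U -> {additive msec U -> msec V};
  mresZ : forall (U V : opens X) (h : V `<=` U) a s,
    mres h (a *: s) = rres O h a *: mres h s;
  modSheafP : is_sheaf mres
}.

Section ModStalk.
Variables (X : topologicalType) (O : ringSheaf X) (F : modSheaf O) (x : X).

Definition mstalk : Type := stalk (modSheafP F) x.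

HB.instance Definition _ := Choice.on mstalk.

Definition mgerm (U : opens X) (Ux : U x) (s : F U) : mstalk :=
  germ (modSheafP F) Ux s.

Let st1 (f : forall U, F U -> F U) : mstalk -> mstalk := @stalk_map1 _ _ _ _ _ f.
Let st2 (f : forall U, F U -> F U -> F U) : mstalk -> mstalk -> mstalk :=
  @stalk_map2 _ _ _ _ _ f.

Definition mstalk_zero : mstalk := @mgerm (opensT X) I 0.
Definition mstalk_opp : mstalk -> mstalk := st1 (fun U => -%R).
Definition mstalk_add : mstalk -> mstalk -> mstalk := st2 (fun U => +%R).

Definition mstalk_scale (c : rstalk O x) (z : mstalk) : mstalk :=
  let U := pgerm_open (crepr c) in let V := pgerm_open (crepr z) in
  mgerm (conj (pgerm_mem (crepr c)) (pgerm_mem (crepr z)) : opensI U V x)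
    (rres O (@opensIl X U V) (pgerm_sec (crepr c)) *:
     mres F (@opensIr X U V) (pgerm_sec (crepr z))).

Lemma mstalk_zeroE (U : opens X) (Ux : U x) : mstalk_zero = mgerm Ux 0.
Proof.
have h : U `<=` opensT X by [].
by rewrite /mgerm -(raddf0 (mres F h)) (germ_res _ h I).
Qed.

Lemma mstalk_oppE (U : opens X) (Ux : U x) a : mstalk_opp (mgerm Ux a) = mgerm Ux (- a).
Proof. by apply: stalk_map1E => *; rewrite raddfN. Qed.

Lemma mstalk_addE (U : opens X) (Ux : U x) a b :
  mstalk_add (mgerm Ux a) (mgerm Ux b) = mgerm Ux (a + b).
Proof. by apply: stalk_map2E => *; rewrite raddfD. Qed.

Lemma mstalk_scaleE (U : opens X) (Ux : U x) a s :
  mstalk_scale (rgerm Ux a) (mgerm Ux s) = mgerm Ux (a *: s).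
Proof.
have [W [h1 [h2 [Wx /= e]]]] := crepr_class (pgerm_equiv (ringSheafP O) x) (PGerm Ux a).
have [W' [h1' [h2' [W'x /= e']]]] :=
  crepr_class (pgerm_equiv (modSheafP F) x) (PGerm Ux s).
have hW := @opensIl X W W'; have hW' := @opensIr X W W'.
have k1 := subset_trans hW h1; have k2 := subset_trans hW h2.
have k1' := subset_trans hW' h1'.
have k : opensI W W' `<=` opensI _ _ :=
  fun y hy => conj (h1 y (proj1 hy)) (h1' y (proj2 hy)).
apply/germP; exists (opensI W W'), k, k2; split => //.
rewrite !mresZ (sheaf_comp (ringSheafP O) _ _ k1) (sheaf_comp (modSheafP F) _ _ k1').
rewrite -(sheaf_comp (ringSheafP O) h1 hW k1) -(sheaf_comp (modSheafP F) h1' hW' k1').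
rewrite e e'.
by rewrite (sheaf_comp (ringSheafP O) _ _ k2) (sheaf_comp (modSheafP F) _ _ k2).
Qed.

Lemma mstalk_addA : associative mstalk_add.
Proof.
move=> z w v; have [U [Ux [a [b [c [-> -> ->]]]]]] := germ_ex3 z w v.
by rewrite !mstalk_addE addrA.
Qed.

Lemma mstalk_addC : commutative mstalk_add.
Proof.
move=> z w; have [U [Ux [a [b [-> ->]]]]] := germ_ex2 z w.
by rewrite !mstalk_addE addrC.
Qed.

Lemma mstalk_add0 : left_id mstalk_zero mstalk_add.
Proof.
move=> z; have [U [Ux [a ->]]] := germ_ex z.
by rewrite (mstalk_zeroE Ux) mstalk_addE add0r.
Qed.

Lemma mstalk_addN : left_inverse mstalk_zero mstalk_opp mstalk_add.
Proof.
move=> z; have [U [Ux [a ->]]] := germ_ex z.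
by rewrite (mstalk_zeroE Ux) mstalk_oppE mstalk_addE addNr.
Qed.

HB.instance Definition _ := GRing.isZmodule.Build mstalk
  mstalk_addA mstalk_addC mstalk_add0 mstalk_addN.

Lemma mgerm_add (U : opens X) (Ux : U x) s t :
  mgerm Ux s + mgerm Ux t = mgerm Ux (s + t).
Proof. exact: mstalk_addE. Qed.

Lemma mstalk_common (c d : rstalk O x) (z w : mstalk) :
  exists (U : opens X) (Ux : U x) a b s t,
    [/\ c = rgerm Ux a, d = rgerm Ux b, z = mgerm Ux s & w = mgerm Ux t].
Proof.
have [U [Ux [a [b [-> ->]]]]] := germ_ex2 c d.
have [V [Vx [s [t [-> ->]]]]] := germ_ex2 z w.
exists (opensI U V), (conj Ux Vx), (rres O (@opensIl X U V) a),
  (rres O (@opensIl X U V) b), (mres F (@opensIr X U V) s), (mres F (@opensIr X U V) t).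
by rewrite /rgerm /mgerm !germ_res.
Qed.

Lemma mstalk_scaleA c d z : mstalk_scale c (mstalk_scale d z) = mstalk_scale (c * d) z.
Proof.
have [U [Ux [a [b [s [_ [-> -> -> _]]]]]]] := mstalk_common c d z z.
by rewrite -rmorphM !mstalk_scaleE scalerA.
Qed.

Lemma mstalk_scale1 : left_id 1 mstalk_scale.
Proof.
move=> z; have [U [Ux [a [b [s [_ [_ _ -> _]]]]]]] := mstalk_common 0 0 z z.
by rewrite -(rmorph1 (rgerm Ux)) mstalk_scaleE scale1r.
Qed.

Lemma mstalk_scaleDr : right_distributive mstalk_scale +%R.
Proof.
move=> c z w; have [U [Ux [a [b [s [t [-> _ -> ->]]]]]]] := mstalk_common c c z w.
by rewrite mgerm_add !mstalk_scaleE mgerm_add scalerDr.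
Qed.

Lemma mstalk_scaleDl z : {morph mstalk_scale^~ z : a b / a + b}.
Proof.
move=> c d; have [U [Ux [a [b [s [_ [-> -> -> _]]]]]]] := mstalk_common c d z z.
by rewrite -rmorphD !mstalk_scaleE mgerm_add scalerDl.
Qed.

HB.instance Definition _ := GRing.Zmodule_isLmodule.Build (rstalk O x) mstalk
  mstalk_scaleA mstalk_scale1 mstalk_scaleDr mstalk_scaleDl.

Section Germ.
Variables (U : opens X) (Ux : U x).

Lemma mgerm_zmod : zmod_morphism (mgerm Ux).
Proof. by move=> a b; rewrite -mstalk_addE -mstalk_oppE. Qed.

HB.instance Definition _ := GRing.isZmodMorphism.Build _ _ (mgerm Ux) mgerm_zmod.

Lemma mgermZ a s : mgerm Ux (a *: s) = rgerm Ux a *: mgerm Ux s.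
Proof. by rewrite -mstalk_scaleE. Qed.

End Germ.

Lemma mgerm_res (U V : opens X) (h : V `<=` U) (Ux : U x) (Vx : V x) s :
  mgerm Vx (mres F h s) = mgerm Ux s.
Proof. exact: germ_res. Qed.

Lemma mgerm_ex (z : mstalk) : exists (U : opens X) (Ux : U x) s, z = mgerm Ux s.
Proof. exact: germ_ex. Qed.

End ModStalk.

Section LocalSections.
Variables (X : topologicalType) (T : X -> Type).

Definition pfun (V : opens X) := forall x, V x -> T x.

Definition pfun_res (U V : opens X) (h : V `<=` U) (s : pfun U) : pfun V :=
  fun x Vx => s x (h x Vx).

Variable P : forall V : opens X, pfun V -> Prop.

Definition locally_sat (V : opens X) (s : pfun V) := forall x, V x ->
  exists (W : opens X) (h : W `<=` V), W x /\ P (pfun_res h s).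

Definition locsec (V : opens X) := {s : pfun V | locally_sat s}.

Lemma locsec_eq (V : opens X) (s t : locsec V) :
  (forall x (Vx : V x), sval s x Vx = sval t x Vx) -> s = t.
Proof.
case: s t => [s Ps] [t Pt] /= st; have {}st : s = t.
  by apply/functional_extensionality_dep => x; apply/functional_extensionality_dep => Vx.
by case: _ / st in Pt *; rewrite (Prop_irrelevance Ps Pt).
Qed.

Hypothesis Pres : forall (U V : opens X) (h : V `<=` U) s, P s -> P (pfun_res h s).

Lemma locally_sat_res (U V : opens X) (h : V `<=` U) s :
  locally_sat s -> locally_sat (pfun_res h s).
Proof.
move=> Ps x Vx; have [W [k [Wx Pk]]] := Ps x (h x Vx).
exists (opensI W V), (@opensIr X W V); split => //.
have := Pres (@opensIl X W V) Pk; congr (P _).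
by apply/functional_extensionality_dep => y; apply/functional_extensionality_dep => Wy;
  congr (s y _).
Qed.

Definition locsec_res (U V : opens X) (h : V `<=` U) (s : locsec U) : locsec V :=
  exist _ _ (locally_sat_res h (svalP s)).

Lemma locsec_sheaf : is_sheaf locsec_res.
Proof.
split.
- by move=> U h s; apply: locsec_eq => x Ux /=; congr (sval s _ _).
- by move=> U V W hVU hWV hWU s; apply: locsec_eq => x Ux /=; congr (sval s _ _).
- move=> U s t e; apply: locsec_eq => x Ux; have [V [h [Vx /(congr1 sval) eV]]] := e x Ux.
  have := congr1 (fun f : pfun V => f x Vx) eV.
  by rewrite /= /pfun_res (Prop_irrelevance (h x Vx) Ux).
- move=> U I V hV s cov comp.
  pose t : pfun U := fun x Ux =>
    let c := cid (cov x Ux) in sval (s (projT1 c)) x (projT2 c).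
  have tE i x (Ux : U x) (Vx : V i x) : t x Ux = sval (s i) x Vx.
    rewrite /t; case: (cid _) => j /= Vjx.
    have Wx : opensI (V j) (V i) x by split.
    have := comp j i _ (@opensIl _ (V j) (V i)) (@opensIr _ (V j) (V i)).
    move=> /(congr1 sval) /(congr1 (fun f : pfun (opensI (V j) (V i)) => f x Wx)) /=.
    rewrite /pfun_res (Prop_irrelevance (opensIl Wx) Vjx)
            (Prop_irrelevance (opensIr Wx) Vx).
    by move=> <-; congr (sval (s j) x _).
  have tP : locally_sat t.
    move=> x Ux; have [i Vix] := cov x Ux.
    have [W [k [Wx Pk]]] := svalP (s i) x Vix.
    exists W, (subset_trans k (hV i)); split=> //; move: Pk; congr (P _).
    apply/functional_extensionality_dep => y; apply/functional_extensionality_dep => Wy.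
    by rewrite /pfun_res (tE i y _ (k y Wy)).
  exists (exist _ t tP) => i; apply: locsec_eq => x Vx /=.
  exact: tE.
Qed.

Lemma locally_sat_const (s : forall x, T x) :
  (forall V : opens X, P (fun (x : X) (_ : V x) => s x)) ->
  forall V : opens X, locally_sat (fun (x : X) (_ : V x) => s x).
Proof. by move=> h V x Vx; exists V, (@subset_refl _ _). Qed.

Lemma locally_sat_op1 (f : forall x, T x -> T x) :
  (forall (V : opens X) (s : pfun V), P s -> P (fun x Vx => f x (s x Vx))) ->
  forall (V : opens X) (s : pfun V), locally_sat s ->
    locally_sat (fun x Vx => f x (s x Vx)).
Proof.
by move=> h V s Ps x Vx; have [W [k [Wx Pk]]] := Ps x Vx; exists W, k; split=> //; exact: h.
Qed.

Lemma locally_sat_op2 (f : forall x, T x -> T x -> T x) :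
  (forall (V : opens X) (s t : pfun V), P s -> P t ->
    P (fun x Vx => f x (s x Vx) (t x Vx))) ->
  forall (V : opens X) (s t : pfun V), locally_sat s -> locally_sat t ->
    locally_sat (fun x Vx => f x (s x Vx) (t x Vx)).
Proof.
move=> h V s t Ps Pt x Vx; have [W [k [Wx Pk]]] := Ps x Vx.
have [W' [k' [W'x Pk']]] := Pt x Vx.
have kl := @opensIl X W W'; have kr := @opensIr X W W'.
exists (opensI W W'), (subset_trans kl k); split=> //.
apply: (h _ (pfun_res (subset_trans kl k) s) (pfun_res (subset_trans kl k) t)).
  have := Pres kl Pk; congr (P _).
  by apply/functional_extensionality_dep => y; apply/functional_extensionality_dep => Wy;
    congr (s y _).
have := Pres kr Pk'; congr (P _).
by apply/functional_extensionality_dep => y; apply/functional_extensionality_dep => Wy;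
  congr (t y _).
Qed.

End LocalSections.

Section SpecTopology.
Variable R : comPzRingType.

HB.instance Definition _ := gen_eqMixin (spec R).
HB.instance Definition _ := gen_choiceMixin (spec R).

Definition spec_open (A : set (spec R)) :=
  exists E : set R, A = [set q : spec R | ~ (E `<=` q)].

Lemma spec_openT : spec_open setT.
Proof.
exists [set 1]; apply/seteqP; split => // q _ /= h.
exact: (@spec_n1 R q (h 1 erefl)).
Qed.

Lemma spec_openI : setI_closed spec_open.
Proof.
move=> _ _ [E ->] [E' ->].
exists [set c | exists a b, [/\ E a, E' b & c = a * b]].
apply/seteqP; split => q /=.
- move=> [] /existsNP [a /not_implyP [Ea na]] /existsNP [b /not_implyP [Eb nb]] h.
  by apply: (spec_nM na nb); apply: h; exists a, b.
- move=> /existsNP [_ /not_implyP [[a [b [Ea Eb ->]]] nab]].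
  have [[_ _ qM] _ _] := specP q; split => h; apply: nab; last by apply: qM; exact: h.
  by rewrite mulrC; apply: qM; exact: h.
Qed.

Lemma spec_open_bigU (I : Type) (f : I -> set (spec R)) :
  (forall i, spec_open (f i)) -> spec_open (\bigcup_i f i).
Proof.
move=> /(_ _)/cid-/all_sig[E fE]; exists (\bigcup_i E i).
apply/seteqP; split => q.
- by move=> [i _]; rewrite fE /= => nE h; apply: nE => a Ea; apply: h; exists i.
- move=> /= /existsNP [a /not_implyP [[i _ Ea] na]].
  by exists i => //; rewrite fE /= => h; apply: na; exact: h.
Qed.

HB.instance Definition _ :=
  isOpenTopological.Build (spec R) spec_openT spec_openI spec_open_bigU.

Lemma spec_openE (A : set (spec R)) : open A = spec_open A.
Proof. by []. Qed.

End SpecTopology.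

Section SpecSheaf.
Variable R : comPzRingType.

Definition is_fraction (V : opens (spec R)) (s : pfun (@loc R) V) :=
  exists a b : R, forall q (Vq : V q), exists hb : ~ q b, s q Vq = frac a hb.

Lemma is_fraction_res (U V : opens (spec R)) (h : V `<=` U) (s : pfun (@loc R) U) :
  is_fraction s -> is_fraction (pfun_res h s).
Proof. by move=> [a [b sE]]; exists a, b => q Vq; have [hb ?] := sE q (h q Vq); exists hb. Qed.

Definition spec_sec (V : opens (spec R)) : Type := locsec is_fraction V.

HB.instance Definition _ V := gen_eqMixin (spec_sec V).
HB.instance Definition _ V := gen_choiceMixin (spec_sec V).

Section Ring.
Variable V : opens (spec R).

Definition spec_const (a : R) : spec_sec V.
Proof.
exists (fun q _ => frac a (@spec_n1 R q)); apply: locally_sat_const => W.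
by exists a, 1 => q Wq; exists (@spec_n1 R q).
Defined.

Definition spec_opp (s : spec_sec V) : spec_sec V.
Proof.
exists (fun q Vq => - sval s q Vq).
apply: (locally_sat_op1 (f := fun q z => - z)) (svalP s) => W t [a [b tE]].
exists (- a), b => q Wq; have [hb ->] := tE q Wq.
by exists hb; rewrite frac_opp.
Defined.

Definition spec_add (s t : spec_sec V) : spec_sec V.
Proof.
exists (fun q Vq => sval s q Vq + sval t q Vq).
apply: (locally_sat_op2 is_fraction_res (f := fun q z w => z + w)) (svalP s) (svalP t).
move=> W u v [a [b uE]] [c [d vE]].
exists (a * d + c * b), (b * d) => q Wq; have [hb ->] := uE q Wq.
have [hd ->] := vE q Wq.
by exists (spec_nM hb hd); rewrite frac_add.
Defined.

Definition spec_mul (s t : spec_sec V) : spec_sec V.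
Proof.
exists (fun q Vq => sval s q Vq * sval t q Vq).
apply: (locally_sat_op2 is_fraction_res (f := fun q z w => z * w)) (svalP s) (svalP t).
move=> W u v [a [b uE]] [c [d vE]].
exists (a * c), (b * d) => q Wq; have [hb ->] := uE q Wq.
have [hd ->] := vE q Wq.
by exists (spec_nM hb hd); rewrite frac_mul.
Defined.

Lemma spec_addA : associative spec_add.
Proof. by move=> s t u; apply: locsec_eq => q Vq /=; rewrite addrA. Qed.
Lemma spec_addC : commutative spec_add.
Proof. by move=> s t; apply: locsec_eq => q Vq /=; rewrite addrC. Qed.
Lemma spec_add0 : left_id (spec_const 0) spec_add.
Proof. by move=> s; apply: locsec_eq => q Vq /=; rewrite -frac0 add0r. Qed.
Lemma spec_addN : left_inverse (spec_const 0) spec_opp spec_add.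
Proof. by move=> s; apply: locsec_eq => q Vq /=; rewrite addNr. Qed.
Lemma spec_mulA : associative spec_mul.
Proof. by move=> s t u; apply: locsec_eq => q Vq /=; rewrite mulrA. Qed.
Lemma spec_mulC : commutative spec_mul.
Proof. by move=> s t; apply: locsec_eq => q Vq /=; rewrite mulrC. Qed.
Lemma spec_mul1 : left_id (spec_const 1) spec_mul.
Proof. by move=> s; apply: locsec_eq => q Vq /=; rewrite -frac1 mul1r. Qed.
Lemma spec_mulD : left_distributive spec_mul spec_add.
Proof. by move=> s t u; apply: locsec_eq => q Vq /=; rewrite mulrDl. Qed.

HB.instance Definition _ := GRing.isZmodule.Build (spec_sec V)
  spec_addA spec_addC spec_add0 spec_addN.
HB.instance Definition _ := GRing.Zmodule_isComPzRing.Build (spec_sec V)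
  spec_mulA spec_mulC spec_mul1 spec_mulD.

Lemma spec_const_zmod : zmod_morphism spec_const.
Proof.
move=> a b; apply: locsec_eq => q Vq /=; rewrite frac_opp frac_add.
by apply: frac_eq; ring.
Qed.

Lemma spec_const_monoid : monoid_morphism spec_const.
Proof.
split=> // a b; apply: locsec_eq => q Vq /=; rewrite frac_mul.
by apply: frac_eq; ring.
Qed.

HB.instance Definition _ := GRing.isZmodMorphism.Build _ _ spec_const spec_const_zmod.
HB.instance Definition _ :=
  GRing.isMonoidMorphism.Build _ _ spec_const spec_const_monoid.

End Ring.

Section Res.
Variables (U V : opens (spec R)) (h : V `<=` U).

Definition spec_res : spec_sec U -> spec_sec V := locsec_res is_fraction_res h.

Lemma spec_res_zmod : zmod_morphism spec_res.
Proof. by move=> s t; apply: locsec_eq. Qed.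
Lemma spec_res_monoid : monoid_morphism spec_res.
Proof. by split=> [|s t]; apply: locsec_eq. Qed.

HB.instance Definition _ := GRing.isZmodMorphism.Build _ _ spec_res spec_res_zmod.
HB.instance Definition _ := GRing.isMonoidMorphism.Build _ _ spec_res spec_res_monoid.

End Res.

Definition spec_sheaf : ringSheaf (spec R) :=
  @RingSheaf _ (fun V => spec_sec V) (fun U V h => @spec_res U V h)
    (locsec_sheaf is_fraction_res).

End SpecSheaf.

Record ringedSpace := RingedSpace {
  rs_space :> topologicalType;
  rs_sheaf : ringSheaf rs_space
}.

Notation "''O_' X" := (rs_sheaf X) (at level 8, X at level 2, format "''O_' X").

Record mor (Y X : ringedSpace) := Mor {
  mfun :> Y -> X;
  mcont : continuous mfun;
  mpull : forall U : opens X, {rmorphism 'O_X U -> 'O_Y (opens_preim mcont U)};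
  mpull_res : forall (U V : opens X) (h : V `<=` U)
      (h' : opens_preim mcont V `<=` opens_preim mcont U) a,
    mpull V (rres 'O_X h a) = rres 'O_Y h' (mpull U a)
}.

Arguments mcont {Y X} m.
Arguments mpull_res {Y X} m [U V].

Section MorComp.
Variables (Z Y X : ringedSpace) (f : mor Y X) (g : mor Z Y).

Lemma mcomp_cont : continuous (f \o g).
Proof. by move=> z; apply: continuous_comp; exact: mcont. Qed.

(* The preimages of U under f \o g and under f and then g are convertible as
   sets, but not as bundled open sets. *)
Lemma mcomp_preim (U : opens X) :
  opens_preim mcomp_cont U `<=` opens_preim (mcont g) (opens_preim (mcont f) U).
Proof. by []. Qed.

Definition mcomp_pull (U : opens X) :
    {rmorphism 'O_X U -> 'O_Z (opens_preim mcomp_cont U)} :=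
  rres 'O_Z (@mcomp_preim U) \o (mpull g _ \o mpull f U).

Lemma mcomp_pull_res (U V : opens X) (h : V `<=` U)
    (h' : opens_preim mcomp_cont V `<=` opens_preim mcomp_cont U) a :
  mcomp_pull V (rres 'O_X h a) = rres 'O_Z h' (mcomp_pull U a).
Proof.
have k : opens_preim (mcont f) V `<=` opens_preim (mcont f) U.
  by move=> y; exact: h.
have k' : opens_preim (mcont g) (opens_preim (mcont f) V) `<=`
    opens_preim (mcont g) (opens_preim (mcont f) U) by move=> z; exact: h.
rewrite /mcomp_pull /= (mpull_res f h k) (mpull_res g k k').
have k'' : opens_preim mcomp_cont V `<=`
    opens_preim (mcont g) (opens_preim (mcont f) U) by move=> z; exact: h.
by rewrite !(sheaf_comp (ringSheafP 'O_Z) _ _ k'').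
Qed.

Definition mcomp : mor Z X := Mor mcomp_pull_res.

End MorComp.

Definition Spec_of (R : comPzRingType) : ringedSpace := RingedSpace (spec_sheaf R).

Section SpecMor.
Variables (R S : comPzRingType) (phi : {rmorphism R -> S}).

Lemma spec_comap_cont : continuous (@spec_comap R S phi).
Proof.
apply/continuousP => _ [E ->]; rewrite spec_openE; exists (phi @` E).
apply/seteqP; split => q /= nE h; apply: nE.
  by move=> a Ea /=; apply: h; exists a.
by move=> _ [a Ea <-]; exact: h.
Qed.

Section Pull.
Variable U : opens (spec R).

Lemma spec_pull_subproof (s : spec_sec U) : locally_sat (@is_fraction S)
  (fun (q : spec S) (Uq : opens_preim spec_comap_cont U q) =>
     loc_map (sval s (spec_comap phi q) Uq)).
Proof.
move=> q Uq; have [W [h [Wq [a [b sE]]]]] := svalP s _ Uq.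
have k : opens_preim spec_comap_cont W `<=` opens_preim spec_comap_cont U.
  by move=> z; exact: h.
exists (opens_preim spec_comap_cont W), k; split => //.
exists (phi a), (phi b) => z Wz; have [hb e] := sE _ Wz.
exists hb; rewrite -loc_mapE -e /pfun_res.
by congr (loc_map (sval s _ _)).
Qed.

Definition spec_pull (s : spec_sec U) : spec_sec (opens_preim spec_comap_cont U) :=
  exist _ _ (spec_pull_subproof s).

Lemma spec_pull_zmod : zmod_morphism spec_pull.
Proof. by move=> s t; apply: locsec_eq => q Uq /=; rewrite rmorphB. Qed.
Lemma spec_pull_monoid : monoid_morphism spec_pull.
Proof.
by split=> [|s t]; apply: locsec_eq => q Uq /=; rewrite ?rmorphM// -!frac1 rmorph1.
Qed.

HB.instance Definition _ := GRing.isZmodMorphism.Build _ _ spec_pull spec_pull_zmod.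
HB.instance Definition _ :=
  GRing.isMonoidMorphism.Build _ _ spec_pull spec_pull_monoid.

End Pull.

Lemma spec_pull_res (U V : opens (spec R)) (h : V `<=` U)
    (h' : opens_preim spec_comap_cont V `<=` opens_preim spec_comap_cont U)
    (s : spec_sec U) :
  spec_pull (spec_res h s) = spec_res h' (spec_pull s).
Proof.
by apply: locsec_eq => q Vq /=; rewrite /pfun_res; congr (loc_map (sval s _ _)).
Qed.

Definition Spec_mor : mor (Spec_of S) (Spec_of R) :=
  @Mor (Spec_of S) (Spec_of R) (@spec_comap R S phi) spec_comap_cont
    (fun U => @spec_pull U) spec_pull_res.

End SpecMor.

(* An isomorphism of ringed spaces from Y onto an open subspace of X, spelled out
   on points and on sections over open subsets of the image. *)
Definition open_immersion (Y X : ringedSpace) (f : mor Y X) :=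
  [/\ injective f,
      forall V : set Y, open V -> open (f @` V) &
      forall V : opens X, V `<=` range f -> bijective (mpull f V)].

(* An affine open neighbourhood of x, given as an open immersion from a
   spectrum. *)
Record affine_chart (X : ringedSpace) (x : X) := AffineChart {
  chart_ring : comPzRingType;
  chart_mor : mor (Spec_of chart_ring) X;
  chart_imm : open_immersion chart_mor;
  chart_mem : range chart_mor x
}.

(* An isomorphism of ringed spaces between locally ringed spaces is local, so
   charts need no locality condition. *)
Record scheme := Scheme {
  scheme_space :> ringedSpace;
  scheme_local : forall x : scheme_space, local_ring (rstalk 'O_scheme_space x);
  scheme_affine : forall x : scheme_space, inhabited (affine_chart x)
}.

Definition locally_noetherian (X : scheme) :=
  forall x : X, exists c : affine_chart x, noetherian_ring (chart_ring c).

Definition noetherian_scheme (X : scheme) :=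
  locally_noetherian X /\ compact [set: X].

Section ChartGerm.
Variables (X : ringedSpace) (x : X) (c : affine_chart x).
Let R := chart_ring c.
Let f : mor (Spec_of R) X := chart_mor c.

Lemma chart_open_subproof : open (range f).
Proof. by case: (chart_imm c) => _ + _; apply; exact: openT. Qed.

Definition chart_open : opens X := Opens chart_open_subproof.

Lemma chart_bij : bijective (mpull f chart_open).
Proof. by case: (chart_imm c) => _ _; apply. Qed.

Lemma chart_sec_ex (a : R) : exists s : 'O_X chart_open,
  mpull f chart_open s = spec_const (opens_preim (mcont f) chart_open) a.
Proof. by case: chart_bij => g _ gK; exists (g (spec_const _ a)); rewrite gK. Qed.

Definition chart_sec (a : R) : 'O_X chart_open := sval (cid (chart_sec_ex a)).

Lemma chart_secE (a : R) :
  mpull f chart_open (chart_sec a) = spec_const (opens_preim (mcont f) chart_open) a.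
Proof. exact: (svalP (cid (chart_sec_ex a))). Qed.

Lemma chart_sec_zmod : zmod_morphism chart_sec.
Proof.
move=> a b; apply: (bij_inj chart_bij).
by rewrite rmorphB !chart_secE rmorphB.
Qed.

Lemma chart_sec_monoid : monoid_morphism chart_sec.
Proof.
split=> [|a b]; apply: (bij_inj chart_bij).
  by rewrite chart_secE !rmorph1.
by rewrite rmorphM !chart_secE rmorphM.
Qed.

HB.instance Definition _ := GRing.isZmodMorphism.Build _ _ chart_sec chart_sec_zmod.
HB.instance Definition _ := GRing.isMonoidMorphism.Build _ _ chart_sec chart_sec_monoid.

Definition chart_germ : {rmorphism R -> rstalk 'O_X x} :=
  @rgerm _ 'O_X x chart_open (chart_mem c) \o chart_sec.

End ChartGerm.

(* Spec O_{X,x} -> Spec R -> X, for some affine open neighbourhood Spec R of x;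
   the morphism does not depend on that neighbourhood. *)
Definition canonical_mor (X : scheme) (x : X) : mor (Spec_of (rstalk 'O_X x)) X :=
  let c := inhabited_witness (scheme_affine x) in
  mcomp (chart_mor c) (Spec_mor (chart_germ c)).

Section ModHom.
Variables (X : topologicalType) (O : ringSheaf X).

Record modHom (F G : modSheaf O) := ModHom {
  mh_fun :> forall U : opens X, {linear F U -> G U};
  mh_res : forall (U V : opens X) (h : V `<=` U) s,
    mh_fun V (mres F h s) = mres G h (mh_fun U s)
}.

Record submod (F : modSheaf O) := SubMod {
  sub_pred :> forall U : opens X, F U -> Prop;
  sub0 : forall U, sub_pred (0 : F U);
  subD : forall U (s t : F U), sub_pred s -> sub_pred t -> sub_pred (s + t);
  subZ : forall U a (s : F U), sub_pred s -> sub_pred (a *: s);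
  sub_res : forall (U V : opens X) (h : V `<=` U) s,
    sub_pred s -> sub_pred (mres F h s);
  sub_loc : forall (U : opens X) (s : F U),
    (forall x, U x -> exists (V : opens X) (h : V `<=` U),
       V x /\ sub_pred (mres F h s)) -> sub_pred s
}.

Section Kernel.
Variables (F G : modSheaf O) (f : modHom F G).

Definition ker_pred (U : opens X) (s : F U) := f U s = 0.

Lemma ker0 U : ker_pred (0 : F U).
Proof. by rewrite /ker_pred raddf0. Qed.
Lemma kerD U (s t : F U) : ker_pred s -> ker_pred t -> ker_pred (s + t).
Proof. by rewrite /ker_pred => hs ht; rewrite linearD hs ht addr0. Qed.
Lemma kerZ U a (s : F U) : ker_pred s -> ker_pred (a *: s).
Proof. by rewrite /ker_pred linearZ => /= ->; rewrite scaler0. Qed.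
Lemma ker_res (U V : opens X) (h : V `<=` U) s : ker_pred s -> ker_pred (mres F h s).
Proof. by rewrite /ker_pred mh_res => ->; rewrite raddf0. Qed.
Lemma ker_loc (U : opens X) (s : F U) :
  (forall x, U x -> exists (V : opens X) (h : V `<=` U),
     V x /\ ker_pred (mres F h s)) -> ker_pred s.
Proof.
move=> H; apply: (sheaf_sep (modSheafP G)) => x Ux; have [V [h [Vx e]]] := H x Ux.
by exists V, h; split => //; rewrite -mh_res e raddf0.
Qed.

Definition ker : submod F := SubMod ker0 kerD kerZ ker_res ker_loc.

End Kernel.

Section BigCap.
Variables (F : modSheaf O) (J : Type) (P : J -> Prop) (H : J -> submod F).

(* The kernel of F -> prod_{j, P j} F / H j: since H j is a subsheaf, it is the
   kernel of F -> F / H j. *)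
Definition bigcap_pred (U : opens X) (s : F U) := forall j, P j -> H j U s.

Lemma bigcap0 U : bigcap_pred (0 : F U).
Proof. by move=> j Pj; exact: sub0. Qed.
Lemma bigcapD U (s t : F U) : bigcap_pred s -> bigcap_pred t -> bigcap_pred (s + t).
Proof. by move=> hs ht j Pj; apply: subD; [exact: hs|exact: ht]. Qed.
Lemma bigcapZ U a (s : F U) : bigcap_pred s -> bigcap_pred (a *: s).
Proof. by move=> hs j Pj; apply: subZ; exact: hs. Qed.
Lemma bigcap_res (U V : opens X) (h : V `<=` U) s :
  bigcap_pred s -> bigcap_pred (mres F h s).
Proof. by move=> hs j Pj; apply: sub_res; exact: hs. Qed.
Lemma bigcap_loc (U : opens X) (s : F U) :
  (forall x, U x -> exists (V : opens X) (h : V `<=` U),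
     V x /\ bigcap_pred (mres F h s)) -> bigcap_pred s.
Proof.
move=> hs j Pj; apply: sub_loc => x Ux; have [V [h [Vx e]]] := hs x Ux.
by exists V, h; split => //; exact: e.
Qed.

Definition submod_bigcap : submod F :=
  SubMod bigcap0 bigcapD bigcapZ bigcap_res bigcap_loc.

End BigCap.

Section SubSheaf.
Variables (F : modSheaf O) (H : submod F).

Definition sub_sec (U : opens X) : Type := {s : F U | H U s}.

HB.instance Definition _ U := gen_eqMixin (sub_sec U).
HB.instance Definition _ U := gen_choiceMixin (sub_sec U).

Lemma sub_sec_eq U (s t : sub_sec U) : sval s = sval t -> s = t.
Proof.
case: s t => [s hs] [t ht] /= st; case: _ / st in ht *.
by rewrite (Prop_irrelevance hs ht).
Qed.

Section Module.
Variable U : opens X.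

Lemma subN (s : F U) : H U s -> H U (- s).
Proof. by move=> hs; rewrite -scaleN1r; exact: subZ. Qed.

Definition sub_sec_zero : sub_sec U := exist _ 0 (sub0 H U).
Definition sub_sec_opp (s : sub_sec U) : sub_sec U := exist _ _ (subN (svalP s)).
Definition sub_sec_add (s t : sub_sec U) : sub_sec U :=
  exist _ _ (subD (svalP s) (svalP t)).
Definition sub_sec_scale (a : O U) (s : sub_sec U) : sub_sec U :=
  exist _ _ (subZ a (svalP s)).

Lemma sub_sec_addA : associative sub_sec_add.
Proof. by move=> *; apply: sub_sec_eq; rewrite /= addrA. Qed.
Lemma sub_sec_addC : commutative sub_sec_add.
Proof. by move=> *; apply: sub_sec_eq; rewrite /= addrC. Qed.
Lemma sub_sec_add0 : left_id sub_sec_zero sub_sec_add.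
Proof. by move=> *; apply: sub_sec_eq; rewrite /= add0r. Qed.
Lemma sub_sec_addN : left_inverse sub_sec_zero sub_sec_opp sub_sec_add.
Proof. by move=> *; apply: sub_sec_eq; rewrite /= addNr. Qed.

HB.instance Definition _ := GRing.isZmodule.Build (sub_sec U)
  sub_sec_addA sub_sec_addC sub_sec_add0 sub_sec_addN.

Lemma sub_sec_scaleA a b s :
  sub_sec_scale a (sub_sec_scale b s) = sub_sec_scale (a * b) s.
Proof. by apply: sub_sec_eq; rewrite /= scalerA. Qed.
Lemma sub_sec_scale1 : left_id 1 sub_sec_scale.
Proof. by move=> *; apply: sub_sec_eq; rewrite /= scale1r. Qed.
Lemma sub_sec_scaleDr : right_distributive sub_sec_scale +%R.
Proof. by move=> *; apply: sub_sec_eq; rewrite /= scalerDr. Qed.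
Lemma sub_sec_scaleDl s : {morph sub_sec_scale^~ s : a b / a + b}.
Proof. by move=> *; apply: sub_sec_eq; rewrite /= scalerDl. Qed.

HB.instance Definition _ := GRing.Zmodule_isLmodule.Build (O U) (sub_sec U)
  sub_sec_scaleA sub_sec_scale1 sub_sec_scaleDr sub_sec_scaleDl.

End Module.

Section Res.
Variables (U V : opens X) (h : V `<=` U).

Definition sub_sec_res (s : sub_sec U) : sub_sec V := exist _ _ (sub_res h (svalP s)).

Lemma sub_sec_res_zmod : zmod_morphism sub_sec_res.
Proof. by move=> s t; apply: sub_sec_eq; rewrite /= raddfB. Qed.

HB.instance Definition _ :=
  GRing.isZmodMorphism.Build _ _ sub_sec_res sub_sec_res_zmod.

Lemma sub_sec_resZ a s : sub_sec_res (a *: s) = rres O h a *: sub_sec_res s.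
Proof. by apply: sub_sec_eq; rewrite /= mresZ. Qed.

End Res.

Lemma sub_sheafP : is_sheaf sub_sec_res.
Proof.
have [Fid Fcomp Fsep Fglue] := modSheafP F; split.
- by move=> U h s; apply: sub_sec_eq; rewrite /= Fid.
- by move=> U V W hVU hWV hWU s; apply: sub_sec_eq; exact: Fcomp.
- move=> U s t e; apply: sub_sec_eq; apply: Fsep => x Ux.
  by have [V [h [Vx /(congr1 sval) e']]] := e x Ux; exists V, h.
- move=> U I V hV s cov comp.
  have [|t tE] := Fglue U I V hV (fun i => sval (s i)) cov.
    by move=> i j W hi hj; exact: (congr1 sval (comp i j W hi hj)).
  have Ht : H U t.
    apply: sub_loc => x Ux; have [i Vix] := cov x Ux; exists (V i), (hV i).
    by rewrite tE; split=> //; exact: svalP.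
  by exists (exist _ t Ht) => i; apply: sub_sec_eq; exact: tE.
Qed.

Definition sub_sheaf : modSheaf O :=
  @ModSheaf X O (fun U => sub_sec U) (fun U V h => @sub_sec_res U V h)
    sub_sec_resZ sub_sheafP.

End SubSheaf.

End ModHom.

Coercion sub_sheaf : submod >-> modSheaf.

Section DirectImage.
Variables (Y X : ringedSpace) (f : mor Y X) (G : modSheaf 'O_Y).

Definition push_sec (U : opens X) : lmodType ('O_X U) :=
  restrict_scalars (mpull f U) (G (opens_preim (mcont f) U)).

Section Res.
Variables (U V : opens X) (h : V `<=` U).

Lemma preimS : opens_preim (mcont f) V `<=` opens_preim (mcont f) U.
Proof. by move=> y; exact: h. Qed.

Definition push_res (s : push_sec U) : push_sec V := mres G preimS s.

Lemma push_res_zmod : zmod_morphism push_res.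
Proof. exact: raddfB. Qed.

HB.instance Definition _ := GRing.isZmodMorphism.Build _ _ push_res push_res_zmod.

Lemma push_resZ a s : push_res (a *: s) = rres 'O_X h a *: push_res s.
Proof.
transitivity (mpull f V (rres 'O_X h a) *: mres G preimS s) => //.
by rewrite (mpull_res f h preimS) -mresZ.
Qed.

End Res.

Lemma push_sheafP : is_sheaf push_res.
Proof.
have [Gid Gcomp Gsep Gglue] := modSheafP G; split.
- by move=> U h s; exact: Gid.
- by move=> U V W hVU hWV hWU s; exact: Gcomp.
- move=> U s t e; apply: Gsep => y Uy; have [V [h [Vy e']]] := e _ Uy.
  by exists (opens_preim (mcont f) V), (preimS h).
- move=> U I V hV s cov comp.
  have [| |t tE] := Gglue (opens_preim (mcont f) U) I
    (fun i => opens_preim (mcont f) (V i)) (fun i => preimS (hV i)) s.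
  + by move=> y Uy; exact: cov.
  + move=> i j W hi hj.
    have k : W `<=` opens_preim (mcont f) (opensI (V i) (V j)).
      by move=> y Wy; split; [exact: hi|exact: hj].
    rewrite -(Gcomp _ _ _ (preimS (@opensIl _ (V i) (V j))) k hi).
    rewrite -(Gcomp _ _ _ (preimS (@opensIr _ (V i) (V j))) k hj).
    by congr (mres G k _); exact: comp.
  + by exists t => i; exact: tE.
Qed.

Definition direct_image : modSheaf 'O_X :=
  @ModSheaf X 'O_X push_sec (fun U V h => @push_res U V h) push_resZ push_sheafP.

End DirectImage.

Arguments preimS {Y X} f [U V] h.

Section StalkMap.
Variables (Y X : ringedSpace) (f : mor Y X) (y : Y).

Definition stalk_map (z : rstalk 'O_X (f y)) : rstalk 'O_Y y :=
  @rgerm _ 'O_Y y (opens_preim (mcont f) (pgerm_open (crepr z)))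
    (pgerm_mem (crepr z)) (mpull f _ (pgerm_sec (crepr z))).

Lemma stalk_mapE (U : opens X) (Ufy : U (f y)) a :
  stalk_map (rgerm Ufy a) =
  @rgerm _ 'O_Y y (opens_preim (mcont f) U) Ufy (mpull f U a).
Proof.
have [W [h1 [h2 [Wx /= e]]]] :=
  crepr_class (pgerm_equiv (ringSheafP 'O_X) (f y)) (PGerm Ufy a).
apply/germP; exists (opens_preim (mcont f) W), (preimS f h1), (preimS f h2).
by split=> //; rewrite -(mpull_res f h1) -(mpull_res f h2) e.
Qed.

Lemma stalk_map_zmod : zmod_morphism stalk_map.
Proof.
move=> z w; have [U [Ux [a [b [-> ->]]]]] := germ_ex2 z w.
rewrite -/(rgerm Ux a) -/(rgerm Ux b).
by rewrite -(rmorphB (rgerm Ux)) !stalk_mapE !rmorphB.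
Qed.

Lemma stalk_map_monoid : monoid_morphism stalk_map.
Proof.
split=> [|z w].
  by rewrite -(rmorph1 (@rgerm _ 'O_X (f y) (opensT X) I)) stalk_mapE !rmorph1.
have [U [Ux [a [b [-> ->]]]]] := germ_ex2 z w.
rewrite -/(rgerm Ux a) -/(rgerm Ux b).
by rewrite -(rmorphM (rgerm Ux)) !stalk_mapE !rmorphM.
Qed.

HB.instance Definition _ := GRing.isZmodMorphism.Build _ _ stalk_map stalk_map_zmod.
HB.instance Definition _ :=
  GRing.isMonoidMorphism.Build _ _ stalk_map stalk_map_monoid.

End StalkMap.

Arguments stalk_map {Y X} f y z.

(* f^* F = f^{-1} F (x)_{f^{-1} O_X} O_Y, as the sheaf of those families of
   elements of the stalks F_{f y} (x)_{O_{X, f y}} O_{Y, y} that are locally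
   given by finite sums of tensors s (x) a of sections. *)
Section InverseImage.
Variables (Y X : ringedSpace) (f : mor Y X) (F : modSheaf 'O_X).

Definition inv_stalk (y : Y) : lmodType (rstalk 'O_Y y) :=
  base_change (stalk_map f y) (mstalk F (f y)).

Record tsec (V : opens Y) := TSec {
  tsec_open : opens X;
  tsec_sub : V `<=` f @^-1` tsec_open;
  tsec_mod : F tsec_open;
  tsec_ring : 'O_Y V
}.

Definition tsec_germ (V : opens Y) (t : tsec V) (y : Y) (Vy : V y) : inv_stalk y :=
  pure_tensor (stalk_map f y)
    (mgerm (tsec_sub t Vy : tsec_open t (f y)) (tsec_mod t))
    (rgerm Vy (tsec_ring t)).

Definition is_tensor (V : opens Y) (s : pfun inv_stalk V) :=
  exists l : seq (tsec V), forall y (Vy : V y), s y Vy = \sum_(t <- l) tsec_germ t Vy.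

Lemma is_tensor_res (U V : opens Y) (h : V `<=` U) (s : pfun inv_stalk U) :
  is_tensor s -> is_tensor (pfun_res h s).
Proof.
move=> [l sE]; exists [seq TSec (subset_trans h (@tsec_sub _ t)) (tsec_mod t)
                            (rres 'O_Y h (tsec_ring t)) | t <- l] => y Vy.
rewrite /pfun_res sE big_map; apply: eq_bigr => t _; rewrite /tsec_germ /=.
rewrite (rgerm_res _ (h y Vy)).
by congr (pure_tensor _ (mgerm _ _) _).
Qed.

Definition inv_sec (V : opens Y) : Type := locsec is_tensor V.

HB.instance Definition _ V := gen_eqMixin (inv_sec V).
HB.instance Definition _ V := gen_choiceMixin (inv_sec V).

Section Module.
Variable V : opens Y.

Definition inv_zero : inv_sec V.
Proof.
exists (fun y _ => 0); apply: locally_sat_const => W.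
by exists [::] => y Wy; rewrite big_nil.
Defined.

Definition inv_add (s t : inv_sec V) : inv_sec V.
Proof.
exists (fun y Vy => sval s y Vy + sval t y Vy).
apply: (locally_sat_op2 is_tensor_res (f := fun y z w => z + w)) (svalP s) (svalP t).
move=> W u v [l uE] [l' vE]; exists (l ++ l') => y Wy.
by rewrite uE vE big_cat.
Defined.

Definition inv_scale (a : 'O_Y V) (s : inv_sec V) : inv_sec V.
Proof.
exists (fun y Vy => rgerm Vy a *: sval s y Vy) => y Vy.
have [W [h [Wy [l sE]]]] := svalP s y Vy.
exists W, h; split => //.
exists [seq TSec (@tsec_sub _ t) (tsec_mod t) (rres 'O_Y h a * tsec_ring t) | t <- l].
move=> z Wz; rewrite /pfun_res big_map.
transitivity (rgerm Wz (rres 'O_Y h a) *: \sum_(t <- l) tsec_germ t Wz).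
  by rewrite -sE (rgerm_res _ (h z Wz)).
rewrite scaler_sumr; apply: eq_bigr => t _.
by rewrite /tsec_germ /= rmorphM pure_tensorZ.
Defined.

Definition inv_opp (s : inv_sec V) : inv_sec V := inv_scale (-1) s.

Lemma inv_addA : associative inv_add.
Proof. by move=> s t u; apply: locsec_eq => y Vy /=; rewrite addrA. Qed.
Lemma inv_addC : commutative inv_add.
Proof. by move=> s t; apply: locsec_eq => y Vy /=; rewrite addrC. Qed.
Lemma inv_add0 : left_id inv_zero inv_add.
Proof. by move=> s; apply: locsec_eq => y Vy /=; rewrite add0r. Qed.
Lemma inv_addN : left_inverse inv_zero inv_opp inv_add.
Proof.
by move=> s; apply: locsec_eq => y Vy /=; rewrite rmorphN rmorph1 scaleN1r addNr.
Qed.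

HB.instance Definition _ := GRing.isZmodule.Build (inv_sec V)
  inv_addA inv_addC inv_add0 inv_addN.

Lemma inv_scaleA a b s : inv_scale a (inv_scale b s) = inv_scale (a * b) s.
Proof. by apply: locsec_eq => y Vy /=; rewrite rmorphM scalerA. Qed.
Lemma inv_scale1 : left_id 1 inv_scale.
Proof. by move=> s; apply: locsec_eq => y Vy /=; rewrite rmorph1 scale1r. Qed.
Lemma inv_scaleDr : right_distributive inv_scale +%R.
Proof. by move=> a s t; apply: locsec_eq => y Vy /=; rewrite scalerDr. Qed.
Lemma inv_scaleDl s : {morph inv_scale^~ s : a b / a + b}.
Proof. by move=> a b; apply: locsec_eq => y Vy /=; rewrite rmorphD scalerDl. Qed.

HB.instance Definition _ := GRing.Zmodule_isLmodule.Build ('O_Y V) (inv_sec V)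
  inv_scaleA inv_scale1 inv_scaleDr inv_scaleDl.

End Module.

Section Res.
Variables (U V : opens Y) (h : V `<=` U).

Definition inv_res : inv_sec U -> inv_sec V := locsec_res is_tensor_res h.

Lemma inv_res_zmod : zmod_morphism inv_res.
Proof.
by move=> s t; apply: locsec_eq => y Vy /=; rewrite /pfun_res /= !rmorphN !rmorph1.
Qed.

HB.instance Definition _ := GRing.isZmodMorphism.Build _ _ inv_res inv_res_zmod.

Lemma inv_resZ a s : inv_res (a *: s) = rres 'O_Y h a *: inv_res s.
Proof.
by apply: locsec_eq => y Vy /=; rewrite /pfun_res /= (rgerm_res _ (@h y Vy)).
Qed.

End Res.

Definition inverse_image : modSheaf 'O_Y :=
  @ModSheaf Y 'O_Y (fun U => inv_sec U) (fun U V h => @inv_res U V h)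
    inv_resZ (locsec_sheaf is_tensor_res).

End InverseImage.

(* The unit F -> f_* f^* F sends s to s (x) 1. *)
Section AdjunctionUnit.
Variables (Y X : ringedSpace) (f : mor Y X) (F : modSheaf 'O_X).

Section Sec.
Variable U : opens X.

Definition unit_pfun (s : F U) : pfun (inv_stalk f F) (opens_preim (mcont f) U) :=
  fun y Uy => pure_tensor (stalk_map f y) (@mgerm _ _ F (f y) U Uy s) 1.

Lemma unit_subproof (s : F U) : locally_sat (@is_tensor Y X f F) (unit_pfun s).
Proof.
move=> y Uy; exists (opens_preim (mcont f) U), (@subset_refl _ _); split=> //.
exists [:: @TSec Y X f F (opens_preim (mcont f) U) U (@subset_refl _ _) s 1] => z Uz.
rewrite big_seq1 /tsec_germ /= rmorph1 /pfun_res /unit_pfun.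
by congr (pure_tensor _ (mgerm _ _) _).
Qed.

Definition unit_sec (s : F U) : direct_image f (inverse_image f F) U :=
  exist _ _ (unit_subproof s).

Lemma unit_sec_linear : linear unit_sec.
Proof.
move=> a s t; apply: locsec_eq => y Uy.
rewrite /= /unit_pfun raddfD /= mgermZ pure_tensorDl pure_tensorZl.
by rewrite /= (@stalk_mapE Y X f y U Uy a) pure_tensorZ.
Qed.

HB.instance Definition _ := GRing.isLinear.Build _ _ _ _ unit_sec unit_sec_linear.

End Sec.

Lemma unit_sec_res (U V : opens X) (h : V `<=` U) (s : F U) :
  unit_sec (mres F h s) = mres (direct_image f (inverse_image f F)) h (unit_sec s).
Proof.
apply: locsec_eq => y Vy /=; rewrite /unit_pfun /pfun_res.
by rewrite (@mgerm_res _ _ F (f y) U V h (preimS f h y Vy) Vy s).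
Qed.

Definition adj_unit : modHom F (direct_image f (inverse_image f F)) :=
  @ModHom _ _ F (direct_image f (inverse_image f F)) (fun U => @unit_sec U) unit_sec_res.

End AdjunctionUnit.

Section Coherent.
Variables (X : topologicalType) (O : ringSheaf X) (F : modSheaf O).

Definition lin_comb (U : opens X) n (s : 'I_n -> F U) (V : opens X) (h : V `<=` U)
    (a : 'I_n -> O V) : F V := \sum_i a i *: mres F h (s i).

(* Locally, F is the target of a surjection from some O^n. *)
Definition finite_type := forall x, exists (U : opens X) n (s : 'I_n -> F U), U x /\
  forall (V : opens X) (h : V `<=` U) (t : F V) y, V y ->
  exists (W : opens X) (k : W `<=` V), W y /\
  exists a : 'I_n -> O W, mres F k t = lin_comb s (subset_trans k h) a.

(* The kernel of every morphism s : O_U^n -> F|_U is of finite type: near each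
   point it is generated by finitely many relations r_1, ..., r_m. *)
Definition finite_type_relations :=
  forall (U : opens X) n (s : 'I_n -> F U) x, U x ->
  exists (V : opens X) (h : V `<=` U), V x /\
  exists m (r : 'I_m -> 'I_n -> O V), (forall j, lin_comb s h (r j) = 0) /\
  forall (W : opens X) (k : W `<=` V) (a : 'I_n -> O W),
    lin_comb s (subset_trans k h) a = 0 ->
  forall y, W y -> exists (W' : opens X) (k' : W' `<=` W), W' y /\
  exists c : 'I_m -> O W', forall i,
    rres O k' (a i) = \sum_j c j * rres O (subset_trans k' k) (r j i).

Definition coherent := finite_type /\ finite_type_relations.

(* A finite direct sum of sheaves is computed on sections. *)
Definition internal_direct_sum n (H : 'I_n -> submod F) :=
  forall (U : opens X) (s : F U), exists! t : {ffun 'I_n -> F U},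
    (forall i, H i U (t i)) /\ s = \sum_i t i.

End Coherent.

Definition Ass (X : scheme) (F : modSheaf 'O_X) : set X :=
  [set x | exists s : mstalk F x, annihilator s = max_ideal (scheme_local x)].

(* Main.v *)
Require Import Defs.
From mathcomp Require Import all_boot all_order all_algebra ring.
From mathcomp Require Import boolp classical_sets topology.

Set Implicit Arguments.
Unset Strict Implicit.
Unset Printing Implicit Defensive.

Import GRing.Theory.
Local Open Scope classical_set_scope.
Local Open Scope ring_scope.

(* A section of F vanishes at a point x as soon as it vanishes at every associated
   point specializing to x: a nonzero germ has a multiple whose annihilator is a
   prime of O_{X,x}, and this prime is a point y of Ass(F). Hence F is supported on
   the disjoint closed sets Z_i, the closures of the p_i. A section is killed by
   the unit of t_j iff its germs at all generizations of p_j vanish, so F_i consists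
   of the sections supported on Z_i. Restricting a section near Z_i and extending
   it by zero off Z_i is the projection onto F_i. *)

(** * Maximal elements among ideals of a Noetherian ring *)

Section Noetherian.
Variable R : comPzRingType.

(** Serves to place the finitely many generators of the union of a chain of ideals inside a single
    member. *)
Lemma seq_chain_union (T : eqType) (l : seq T) (A : set (set T)) :
  A !=set0 -> total_on A subset -> (forall b, b \in l -> exists2 I, A I & I b) ->
  exists2 I, A I & forall b, b \in l -> I b.
Proof.
move=> [I0 AI0] tot; elim: l => [|b l IH] h; first by exists I0.
have [|I AI Il] := IH; first by move=> b' b'l; apply: h; rewrite inE b'l orbT.
have [|J AJ Jb] := h b; first by rewrite inE eqxx.
have [IJ|JI] := tot _ _ AI AJ; [exists J|exists I] => // b';
  rewrite inE => /orP[/eqP ->//|b'l]; [exact/IJ/Il|exact: JI|exact: Il].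
Qed.

Lemma chain_union_ideal (A : set (set R)) :
  A !=set0 -> total_on A subset -> (forall I, A I -> is_ideal I) ->
  is_ideal (\bigcup_(I in A) I).
Proof.
move=> [I0 AI0] tot Aid; split.
- by exists I0 => //; case: (Aid _ AI0).
- move=> a b [I AI Ia] [J AJ Jb].
  have [IJ|JI] := tot _ _ AI AJ; [exists J|exists I] => //.
    by have [_ JD _] := Aid _ AJ; apply: JD => //; exact: IJ.
  by have [_ ID _] := Aid _ AI; apply: ID => //; exact: JI.
- by move=> r a [I AI Ia]; exists I => //; have [_ _ IM] := Aid _ AI; exact: IM.
Qed.

(** The union of a nonempty chain in [A] is a finitely generated ideal; a member containing the
    generators is the whole union and so an upper bound, and Zorn's lemma applies. *)
Lemma noetherian_maximal (A : set (set R)) :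
  noetherian_ring R -> A !=set0 -> (forall I, A I -> is_ideal I) ->
  exists2 I, A I & forall J, A J -> I `<=` J -> J = I.
Proof.
move=> Rn [I0 AI0] Aid.
(* Zorn's lemma also asks for the union of the empty chain. *)
have [C CP Ctot|M [PM Mmax]] := @Zorn_bigcup R [set I | I = set0 \/ A I].
  have [[I1 [CI1 AI1]]|nCA] := pselect (C `&` A !=set0); last first.
    left; apply/seteqP; split=> // a [I CI Ia].
    by case: (CP _ CI) => [I0'|AI]; [rewrite I0' in Ia|apply: nCA; exists I].
  right; have CAtot : total_on (C `&` A) subset.
    by move=> I J [CI _] [CJ _]; exact: Ctot.
  have ne : C `&` A !=set0 by exists I1.
  have [l lE] := Rn _ (chain_union_ideal ne CAtot (fun I h => Aid I h.2)).
  have [b bl|I [CI AI] Il] := seq_chain_union (l := l) ne CAtot.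
    have : (\bigcup_(I in C `&` A) I) b by rewrite lE => J _; exact.
    by case=> I CAI Ib; exists I.
  suff -> : \bigcup_(J in C) J = I by [].
  apply/seteqP; split=> [a [J CJ Ja]|a Ia]; last by exists I.
  have : (\bigcup_(I in C `&` A) I) a.
    by exists J => //; split=> //; case: (CP _ CJ) => // J0; rewrite J0 in Ja.
  by rewrite lE => /(_ I (Aid _ AI) Il).
have max J : A J -> M `<=` J -> J = M.
  move=> AJ MJ; apply/seteqP; split=> //; apply: contrapT => nJM.
  by apply: (Mmax J); [split|right].
have [M0|AM] := PM; last by exists M.
(* An empty [M] would force [I0] to be empty, but [I0] contains 0. *)
have [] := Aid _ AI0; rewrite (max _ AI0) M0 //.
Qed.

End Noetherian.

(** * Localization at a prime and its maximal ideal *)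

(** A predicate on [phi] rather than an isomorphism with [loc q], so that it applies directly to
    stalks. *)
Definition is_localization (R A : comPzRingType) (q : spec R) (phi : R -> A) :=
  [/\ forall z, exists a b, ~ q b /\ z * phi b = phi a,
      forall a, phi a = 0 -> exists2 u, ~ q u & u * a = 0 &
      forall b, ~ q b -> exists w, w * phi b = 1].

Section LocalizationMaximal.
Variables (R A : comPzRingType) (q : spec R) (phi : {rmorphism R -> A}).
Hypothesis phiL : is_localization q phi.

(** If w = c/d, then u d = u c a for some u outside [q]; the left side is outside [q] and the right
    side inside. *)
Lemma loc_nunit a w : q a -> w * phi a = 1 -> False.
Proof.
move=> qa e; have [num eq0 _] := phiL; have [c [d [nd wE]]] := num w.
have [|u nu uE] := eq0 (c * a - d).
  rewrite rmorphB rmorphM -wE; apply/eqP; rewrite subr_eq0; apply/eqP.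
  by rewrite mulrAC e mul1r.
have [[_ _ qM] _ _] := specP q.
apply: (spec_nM nu nd); suff -> : u * d = u * c * a by exact: qM.
by apply/eqP; rewrite eq_sym -subr_eq0 -[u * d]mul1r mul1r -mulrA -mulrBr uE.
Qed.

Variable m : set A.
Hypothesis mP : maximal_ideal m.

(** The fractions with numerator in [q] form a proper ideal. It contains [m], since a fraction with
    numerator outside [q] is a unit, so maximality of [m] gives equality. *)
Lemma loc_max_fraction z : m z <-> exists a b, [/\ q a, ~ q b & z * phi b = phi a].
Proof.
have [num eq0 unit] := phiL; have [[q0 qD qM] _ _] := specP q.
have [[m0 mD mM] m1 mmax] := mP.
pose I : set A := [set z | exists a b, [/\ q a, ~ q b & z * phi b = phi a]].
suff <- : I = m by [].
apply: mmax.
- split.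
  + by exists 0, 1; split=> //; [exact: spec_n1|rewrite mul0r rmorph0].
  + move=> u v [a [b [qa nb uE]]] [c [d [qc nd vE]]].
    exists (d * a + b * c), (b * d); split; first by apply: qD; apply: qM.
      exact: spec_nM.
    rewrite rmorphD !rmorphM -uE -vE; ring.
  + move=> w u [a [b [qa nb uE]]]; have [c [d [nd wE]]] := num w.
    exists (c * a), (d * b); split; [exact: qM|exact: spec_nM|].
    rewrite !rmorphM -uE -wE; ring.
- move=> [a [b [qa nb]]]; rewrite mul1r => e; have [w wE] := unit _ nb.
  by apply: (loc_nunit (w := w) qa); rewrite -e.
- move=> w mw; have [a [b [nb wE]]] := num w; exists a, b; split=> //.
  apply: contrapT => /unit [v vE]; apply: m1; rewrite -vE -wE.
  by rewrite mulrCA mulrC; exact: mM.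
Qed.

Lemma loc_max_comap a : m (phi a) <-> q a.
Proof.
split=> [/loc_max_fraction [c [b [qc nb e]]]|qa]; last first.
  by apply/loc_max_fraction; exists a, 1; split=> //;
    [exact: spec_n1|rewrite rmorph1 mulr1].
apply: contrapT => na; have [_ _ unit] := phiL.
have [w wE] := unit _ (spec_nM na nb).
by apply: (loc_nunit (w := w) qc); rewrite -e -rmorphM.
Qed.

Lemma loc_max_unit z : ~ m z -> exists w, w * z = 1.
Proof.
move=> nz; have [num _ unit] := phiL; have [a [b [nb zE]]] := num z.
have [|w wE] := unit a.
  by move=> qa; apply: nz; apply/loc_max_fraction; exists a, b.
by exists (w * phi b); rewrite -mulrA [_ * z]mulrC zE.
Qed.

End LocalizationMaximal.

(** * Stalks of the structure sheaf in an affine chart *)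

Section ChartLocalization.
Variables (X : ringedSpace) (x : X) (c : affine_chart x).
Local Notation f := (chart_mor c).

Lemma chart_inj_sec (W : opens X) (s t : 'O_X W) : W `<=` chart_open c ->
  (forall q (Wq : W (f q)), sval (mpull f W s) q Wq = sval (mpull f W t) q Wq) -> s = t.
Proof.
move=> hW e; have [_ _ /(_ W hW) /bij_inj] := chart_imm c; apply.
by apply: locsec_eq => q Wq; exact: e.
Qed.

Lemma chart_sec_at (W : opens X) (h : W `<=` chart_open c)
    (a : chart_ring c) q (Wq : W (f q)) :
  sval (mpull f W (rres 'O_X h (chart_sec a))) q Wq = Defs.frac a (@spec_n1 _ q).
Proof. by rewrite (mpull_res f h (preimS f h)) chart_secE. Qed.

Lemma chart_image_open (V : opens (spec (chart_ring c))) : open (f @` V).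
Proof. by have [_ fo _] := chart_imm c; apply: fo; exact: opensP. Qed.

Definition chart_image V : opens X := Opens (@chart_image_open V).

Lemma chart_imageP V q : chart_image V (f q) -> V q.
Proof. by have [fi _ _] := chart_imm c; move=> [p Vp /fi <-]. Qed.

Lemma chart_image_sub V : chart_image V `<=` chart_open c.
Proof. by move=> _ [p Vp <-]; exists p. Qed.

Variables (y : X) (Uy : chart_open c y).

(** Generalizes [chart_germ] to any point [y] of the chart, so that germs at a point and at its
    generizations are compared through one ring. *)
Definition germ_at : {rmorphism chart_ring c -> rstalk 'O_X y} :=
  rgerm Uy \o @chart_sec _ _ c.

Lemma germ_atE (W : opens X) (h : W `<=` chart_open c) (Wy : W y) (a : chart_ring c) :
  germ_at a = rgerm Wy (rres 'O_X h (chart_sec a)).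
Proof. by rewrite (rgerm_res _ Uy). Qed.

(** Through the chart, sections are functions locally given by fractions: a local expression at [q]
    gives numerator and denominator, and the value at [q] detects the kernel. *)
Lemma germ_at_localization q : f q = y -> is_localization q germ_at.
Proof.
move=> fq; split.
- move=> z; have [U [Uz [s ->]]] := rgerm_ex z.
  have Uq : opens_preim (mcont f) U q by rewrite /= /preimage fq.
  have [V [hV [Vq [a [b sE]]]]] := svalP (mpull f U s) q Uq.
  exists a, b; split; first by have [] := sE q Vq.
  have hU : chart_image V `<=` U by move=> _ [p Vp <-]; exact: (hV p Vp).
  have Vy : chart_image V y by exists q.
  rewrite !(germ_atE (@chart_image_sub V) Vy) -(rgerm_res hU Uz Vy) -rmorphM.
  congr (rgerm _ _); apply: chart_inj_sec; first exact: chart_image_sub.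
  move=> p Wp; rewrite rmorphM /= !chart_sec_at (mpull_res f hU (preimS f hU)) /=.
  have [nb] := sE p (chart_imageP Wp); rewrite /pfun_res => e.
  rewrite (Prop_irrelevance (preimS f hU p Wp) (hV p (chart_imageP Wp))) e.
  by rewrite frac_mul; apply: frac_eq; ring.
- move=> a; rewrite -(rmorph0 (rgerm Uy)) => /germP [W [hW [hW' [Wy e]]]].
  have Wq : W (f q) by rewrite fq.
  have := chart_sec_at hW a Wq; rewrite e rmorph0 rmorph0 => /esym/fracP [u nu uE].
  by exists u => //; move: uE; rewrite !mul0r mulr1 mulr0.
- move=> b nb.
  (* The inverse of [b] is the function 1/b over its basic open set [D], carried to a section over
     the image of [D]. *)
  pose D : opens (spec (chart_ring c)) :=
    @Opens (spec _) [set p : spec _ | ~ ([set b] `<=` p)] (ex_intro _ [set b] erefl).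
  have DP p : D p -> ~ p b by move=> h pb; apply: h => _ ->.
  have Dq : D q by move=> /(_ b erefl).
  pose g : pfun (@loc (chart_ring c)) (opens_preim (mcont f) (chart_image D)) :=
    fun p Dp => Defs.frac 1 (DP p (chart_imageP Dp)).
  have gP : locally_sat (@is_fraction _) g.
    move=> p Dp; exists (opens_preim (mcont f) (chart_image D)), (@subset_refl _ _).
    split=> //; exists 1, b => r Dr.
    by exists (DP r (chart_imageP (subset_refl Dr))).
  have [_ _ /(_ _ (@chart_image_sub D)) [h _ hK]] := chart_imm c.
  have Dy : chart_image D y by exists q.
  exists (rgerm Dy (h (exist _ g gP))).
  rewrite (germ_atE (@chart_image_sub D) Dy) -rmorphM -(rmorph1 (rgerm Dy)).
  congr (rgerm _ _); apply: chart_inj_sec; first exact: chart_image_sub.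
  move=> p Wp; rewrite rmorphM rmorph1 /= !chart_sec_at hK /= /g.
  by rewrite frac_mul; apply: frac_eq; ring.
Qed.

End ChartLocalization.

(** * Specialization and vanishing of germs *)

Lemma closure1P (X : topologicalType) (x y : X) :
  closure [set y] x <-> forall U : opens X, U x -> U y.
Proof.
split=> [cl U Ux|h B]; last first.
  rewrite nbhsE => -[W [Wo Wx] WB]; exists y; split=> //.
  exact/WB/(h (Opens Wo)).
have [] := cl U; last by move=> z [-> ].
by apply: open_nbhs_nbhs; split=> //; exact: opensP.
Qed.

Section Germs.
Variables (X : topologicalType) (O : ringSheaf X) (F : modSheaf O).

Lemma mgerm_eq0 (U : opens X) x (Ux : U x) (s : F U) :
  mgerm Ux s = 0 <-> exists (W : opens X) (h : W `<=` U), W x /\ mres F h s = 0.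
Proof.
rewrite -(raddf0 (@mgerm _ _ F x U Ux)); split.
  move=> /germP [W [h [h' [Wx e]]]].
  by exists W, h; split=> //; rewrite e raddf0.
move=> [W [h [Wx e]]].
by apply/germP; exists W, h, h; split=> //; rewrite e raddf0.
Qed.

Lemma mgerm_eq0_generic (U : opens X) x y (Ux : U x) (Uy : U y) (s : F U) :
  closure [set y] x -> mgerm Ux s = 0 -> mgerm Uy s = 0.
Proof.
move=> /closure1P xy /mgerm_eq0 [W [h [Wx e]]]; apply/mgerm_eq0.
by exists W, h; split=> //; exact: xy.
Qed.

Lemma rgerm_eq_generic (U : opens X) x y (Ux : U x) (Uy : U y) (a b : O U) :
  closure [set y] x -> rgerm Ux a = rgerm Ux b -> rgerm Uy a = rgerm Uy b.
Proof.
move=> /closure1P xy /germP [W [h [h' [Wx e]]]]; apply/germP.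
by exists W, h, h'; split=> //; exact: xy.
Qed.

Lemma mgerm_sep (U : opens X) (s t : F U) :
  (forall x (Ux : U x), mgerm Ux s = mgerm Ux t) -> s = t.
Proof.
move=> e; apply: (sheaf_sep (modSheafP F)) => x Ux.
have /mgerm_eq0 [W [h [Wx e0]]] : mgerm Ux (s - t) = 0 by rewrite raddfB /= e subrr.
by exists W, h; split=> //; apply/eqP; rewrite -subr_eq0 -raddfB e0.
Qed.

(** This is the finiteness of relations for the single section [s], that is for n = 1, passed to the
    stalks at all points near [x]. *)
Lemma annihilator_fg (U : opens X) (s : F U) x : finite_type_relations F -> U x ->
  exists (V : opens X) (h : V `<=` U), V x /\ exists m (r : 'I_m -> O V),
    (forall j, r j *: mres F h s = 0) /\
    forall y (Vy : V y) (a : rstalk O y), a *: mgerm (h y Vy) s = 0 ->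
      exists d : 'I_m -> rstalk O y, a = \sum_j d j * rgerm Vy (r j).
Proof.
move=> rel Ux; have [V [h [Vx [m [r [r0 gen]]]]]] := rel U 1%N (fun=> s) x Ux.
exists V, h; split=> //; exists m, (fun j => r j ord0); split.
  by move=> j; have := r0 j; rewrite /lin_comb big_ord1.
move=> y Vy a; have [W [Wy [b ->]]] := rgerm_ex a.
pose V' := opensI V W; have V'y : V' y by [].
pose hV := @opensIl _ V W; pose hW := @opensIr _ V W.
rewrite -(rgerm_res hW Wy V'y) -(mgerm_res (subset_trans hV h) (h y Vy) V'y) -mgermZ.
move=> /mgerm_eq0 [W' [k [W'y]]]; rewrite mresZ => e.
have [|W'' [k' [W''y [d dE]]]] :=
    gen W' (subset_trans k hV) (fun=> rres O k (rres O hW b)) _ y W'y.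
  rewrite /lin_comb big_ord1 -[RHS]e; congr (_ *: _).
  by rewrite (sheaf_comp (modSheafP F) _ _
    (subset_trans (subset_trans k hV) h)).
exists (fun j => rgerm W''y (d j)).
rewrite -(rgerm_res k V'y W'y) -(rgerm_res k' W'y W''y) (dE ord0) raddf_sum /=.
apply: eq_bigr => j _; rewrite rmorphM /=; congr (_ * _).
exact: rgerm_res.
Qed.

End Germs.

(** * Annihilators of germs and prime annihilators *)

(** A multiple of [s] vanishes on a neighbourhood in the subsheaf exactly when it does in [F];
    associated points of [H] can thus be tested in [F]. *)
Lemma annihilator_sub (X : topologicalType) (O : ringSheaf X) (F : modSheaf O)
    (H : submod F) (U : opens X) x (Ux : U x) (s : sub_sheaf H U) :
  annihilator (mgerm Ux s) = annihilator (mgerm Ux (sval s)).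
Proof.
apply/seteqP; split=> a; have [V [Vx [b ->]]] := rgerm_ex a.
all: pose W := opensI U V; have Wx : W x by [].
all: pose hU := @opensIl _ U V; pose hV := @opensIr _ U V.
all: rewrite /annihilator /= -(rgerm_res hV Vx Wx) -(mgerm_res hU Ux Wx)
  -(mgerm_res hU Ux Wx) -!mgermZ.
all: move=> /mgerm_eq0 [W' [h [W'x e]]]; apply/mgerm_eq0.
all: exists W', h; split=> //.
  exact: (congr1 sval e).
exact: sub_sec_eq.
Qed.

Lemma annihilator_ideal (A : comPzRingType) (M : lmodType A) (m : M) :
  is_ideal (annihilator m).
Proof.
rewrite /annihilator; split=> /= [|a b ma mb|r a ma]; first by rewrite scale0r.
  by rewrite scalerDl ma mb addr0.
by rewrite -scalerA ma scaler0.
Qed.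

Lemma ideal_comap (R A : comPzRingType) (phi : {rmorphism R -> A}) (I : set A) :
  is_ideal I -> is_ideal (phi @^-1` I).
Proof.
move=> [I0 ID IM]; split=> /= [|a b Ia Ib|r a Ia].
- by rewrite rmorph0.
- by rewrite rmorphD; exact: ID.
- by rewrite rmorphM; exact: IM.
Qed.

Lemma ideal_sum (R : comPzRingType) (I : set R) n (a : 'I_n -> R) :
  is_ideal I -> (forall i, I (a i)) -> I (\sum_i a i).
Proof. by move=> [I0 ID _] Ia; elim/big_rec: _ => // i x _; exact: ID. Qed.

(* Among the annihilators of the nonzero multiples of an element, a maximal one
   is prime. *)
Lemma noetherian_prime_annihilator (R A : comPzRingType) (phi : {rmorphism R -> A})
    (M : lmodType A) (m : M) : noetherian_ring R -> m <> 0 ->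
  exists (p : spec R) (a : R), phi a *: m <> 0 /\
    forall r, p r <-> phi r *: (phi a *: m) = 0.
Proof.
move=> Rn m0; pose J a := phi @^-1` annihilator (phi a *: m).
have JI a : is_ideal (J a) by exact/ideal_comap/annihilator_ideal.
have [||P [a [nz PE]] Pmax] := noetherian_maximal
    (A := [set I | exists a, phi a *: m <> 0 /\ I = J a]) Rn.
- by exists (J 1), 1; rewrite rmorph1 scale1r.
- by move=> _ [a [_ ->]].
suff Pprime : prime_ideal P by exists (Spec Pprime), a; split=> // r; rewrite /= PE.
rewrite PE; split; [exact: JI|by rewrite /J /= /annihilator /= rmorph1 scale1r|].
move=> u v uv; have [|nv] := pselect (J a v); [by right|left].
have JE r b : J b r <-> phi (r * b) *: m = 0 by rewrite rmorphM -scalerA.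
have nz' : phi (v * a) *: m <> 0 by move/JE.
(* By maximality [J (v * a)] equals [J a], and it contains [u] because [u * v] lies in [J a]. *)
rewrite -PE -(Pmax (J (v * a))); last 2 first.
- by exists (v * a).
- by move=> r; rewrite PE !JE => e; rewrite mulrCA rmorphM -scalerA e scaler0.
by rewrite JE mulrA -JE.
Qed.

Lemma max_idealP (X : scheme) (x : X) : maximal_ideal (max_ideal (scheme_local x)).
Proof. exact: (svalP (cid (scheme_local x))).1. Qed.

Lemma chart_generic (X : ringedSpace) (x : X) (c : affine_chart x)
    (q p : spec (chart_ring c)) :
  p `<=` q -> closure [set chart_mor c p] (chart_mor c q).
Proof.
move=> pq; apply/closure1P => V Vq.
have [E VE] := opens_preimP (mcont (chart_mor c)) V.
have : (chart_mor c @^-1` V) q by [].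
rewrite VE => nE; suff : (chart_mor c @^-1` V) p by [].
by rewrite VE => Ep; apply: nE => a /Ep/pq.
Qed.

(** * Support and associated points *)

Section AssociatedPoints.
Variables (X : scheme) (F : modSheaf 'O_X).
Hypotheses (X_noeth : locally_noetherian X) (F_rel : finite_type_relations F).

(* [y] is the point, generizing [x], of a prime ideal that annihilates a nonzero
   multiple of [s] at [x]; it is still the whole annihilator at [y] because
   annihilators of sections are finitely generated near [x]. *)
Lemma support_Ass (U : opens X) (s : F U) x (Ux : U x) : mgerm Ux s <> 0 ->
  exists y, [/\ Ass F y, closure [set y] x & exists Uy : U y, mgerm Uy s <> 0].
Proof.
move=> s0; have [c Rn] := X_noeth x.
have [q _ fq] := chart_mem c; have Cx : chart_open c x := chart_mem c.
have gxL := germ_at_localization Cx fq.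
have [p [a [nz pE]]] := noetherian_prime_annihilator (germ_at Cx) Rn s0.
(* Elements outside [q] are units in the stalk at [x] and kill no nonzero germ. *)
have pq : p `<=` q.
  move=> r /pE e; apply: contrapT => nr; have [_ _ unit] := gxL.
  have [w wE] := unit r nr; apply: nz.
  by rewrite -[LHS]scale1r -wE -scalerA e scaler0.
pose y := chart_mor c p; have xy : closure [set y] x.
  by rewrite -fq; exact: chart_generic.
have gen := (closure1P x y).1 xy.
have Cy := gen _ Cx; have gyL := germ_at_localization Cy (erefl y).
pose W := opensI U (chart_open c); have Wx : W x by [].
pose hU := @opensIl _ U (chart_open c); pose hC := @opensIr _ U (chart_open c).
pose s' := rres 'O_X hC (chart_sec a) *: mres F hU s.
have s'E z (Wz : W z) :
    mgerm Wz s' = germ_at (hC z Wz) a *: mgerm (hU z Wz) s.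
  rewrite mgermZ (mgerm_res hU (hU z Wz) Wz); congr (_ *: _).
  exact: rgerm_res.
have s'Ex : mgerm Wx s' = germ_at Cx a *: mgerm Ux s.
  by rewrite s'E (Prop_irrelevance (hC _ _) Cx) (Prop_irrelevance (hU _ _) Ux).
have [V [h [Vx [m [r [r0 rgen]]]]]] := annihilator_fg s' F_rel Wx.
have Vy := gen _ Vx; have Wy := h y Vy.
have Mmax := max_idealP y; set M := max_ideal _ in Mmax.
have [[M0 MD MM] M1 _] := Mmax.
(* Each [r j] kills [s'] at [x], so its numerator lies in [p]; the expression as a fraction persists
   at the generization [y]. *)
have rM j : M (rgerm Vy (r j)).
  have [num _ _] := gxL; have [e [b [nb eE]]] := num (rgerm Vx (r j)).
  apply/(loc_max_fraction gyL Mmax); exists e, b; split.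
  - have rs0 : rgerm Vx (r j) *: mgerm Wx s' = 0.
      by rewrite -(mgerm_res h Wx Vx) -mgermZ r0 raddf0.
    apply/pE; rewrite -eE mulrC -scalerA.
    by move: rs0; rewrite s'Ex => ->; rewrite scaler0.
  - by move/pq.
  - pose hVC := subset_trans h hC.
    move: eE; rewrite !(germ_atE _ hVC Vx) !(germ_atE _ hVC Vy) -!rmorphM.
    exact: rgerm_eq_generic.
(* Otherwise 1 would be a combination of the [r j], all of which lie in [M]. *)
have nz' : mgerm Wy s' <> 0.
  move=> e; have [|d dE] := rgen y Vy 1.
    by rewrite scale1r (Prop_irrelevance (h y Vy) Wy).
  by apply: M1; rewrite dE; apply: ideal_sum => // j; exact: MM.
exists y; split=> //; last first.
  exists (hU y Wy) => e; apply: nz'; by rewrite s'E e scaler0.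
exists (mgerm Wy s'); apply/seteqP; split=> z.
  rewrite /annihilator /= => e; apply: contrapT => nM.
  have [w wE] := loc_max_unit gyL Mmax nM; apply: nz'.
  by rewrite -[LHS]scale1r -wE -scalerA e scaler0.
move=> /(loc_max_fraction gyL Mmax) [b [d [pb nd zE]]].
have [_ _ unit] := gyL; have [w wE] := unit d nd.
have sb : germ_at Cx b *: mgerm Wx s' = 0.
  by rewrite s'Ex; apply/pE.
rewrite /annihilator /= -[z]mul1r -wE -mulrA [_ * z]mulrC zE -scalerA.
suff -> : germ_at Cy b *: mgerm Wy s' = 0 by rewrite scaler0.
move: sb; rewrite (germ_atE _ hC Wx) (germ_atE _ hC Wy) -!mgermZ.
exact: mgerm_eq0_generic.
Qed.

End AssociatedPoints.

(** * The canonical morphism and the kernel of its unit *)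

(** With g the inverse of [phi], the balanced map sending the pair of m and b to [g b *: m] recovers
    [m] from its tensor with 1. *)
Lemma pure_tensor_eq0 (A B : comPzRingType) (phi : {rmorphism A -> B})
    (M : lmodType A) (m : M) :
  bijective phi -> pure_tensor phi m 1 = 0 -> m = 0.
Proof.
move=> [g gK Kg] /cclassP e; pose h (m : M) b := g b *: m.
have gD b b' : g (b + b') = g b + g b'.
  by apply: (can_inj gK); rewrite Kg rmorphD /= !Kg.
have hb : balanced phi h.
  rewrite /h; split=> [n n' b|n b b'|a n b]; first by rewrite scalerDr.
    by rewrite gD scalerDl.
  rewrite scalerA; congr (_ *: _); apply: (can_inj gK).
  by rewrite rmorphM /= !Kg mulrC.
have := e M h hb; rewrite /tens_eval big_seq1 big_nil /h /= => <-.
by rewrite -(rmorph1 phi) gK scale1r.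
Qed.

Section CanonicalMorphism.
Variables (X : scheme) (x : X).
Local Notation A := (rstalk 'O_X x).
Local Notation t := (canonical_mor x).
Local Notation c := (inhabited_witness (scheme_affine x)).
Local Notation phi := (chart_germ c).

Lemma canonical_mor_localization q : chart_mor c q = x -> is_localization q phi.
Proof. exact: germ_at_localization. Qed.

(** Elements of the chart ring outside [q] become units in [A], so every prime of [A] contracts into
    [q]. *)
Lemma canonical_mor_generic (y : spec A) : closure [set t y] x.
Proof.
have [q _ qx] := chart_mem c; rewrite -[X in _ X]qx.
apply: chart_generic => a ya; apply: contrapT => na.
have [_ _ unit] := canonical_mor_localization qx; have [w wE] := unit a na.
apply: (@spec_n1 _ y); have [[_ _ yM] _ _] := specP y.
by rewrite -wE; exact: yM.
Qed.

Lemma max_ideal_prime : prime_ideal (max_ideal (scheme_local x)).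
Proof.
have mP := max_idealP x; set m := max_ideal _ in mP *.
have [mI m1 _] := mP; have [_ _ mM] := mI; split=> // a b mab.
have [|na] := pselect (m a); [by left|right].
have [q _ qx] := chart_mem c.
have [w wE] := loc_max_unit (canonical_mor_localization qx) mP na.
by rewrite -[b]mul1r -wE -mulrA; exact: mM.
Qed.

Definition closed_point : spec A := Spec max_ideal_prime.

Lemma canonical_mor_closed_point : t closed_point = x.
Proof.
have [q _ qx] := chart_mem c; rewrite -[RHS]qx /=; congr (chart_mor c _).
apply: spec_eq => a.
exact: (loc_max_comap (canonical_mor_localization qx) (max_idealP x) a).
Qed.

Definition spec_germ (y : spec A) : {rmorphism A -> rstalk 'O_(Spec_of A) y} :=
  @rgerm _ 'O_(Spec_of A) y (opensT (spec A)) I \o @spec_const A (opensT (spec A)).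

Lemma stalk_map_germ_at (y : spec A) (Uy : chart_open c (t y)) a :
  stalk_map t y (germ_at Uy a) = spec_germ y (phi a).
Proof.
rewrite /germ_at /= stalk_mapE /spec_germ /=.
set V := opens_preim _ _; have hV : V `<=` opensT (spec A) by [].
rewrite -(@rgerm_res _ 'O_(Spec_of A) y _ _ hV I Uy); congr (rgerm _ _).
apply: locsec_eq => z Vz; rewrite /= /pfun_res /= chart_secE /=.
by rewrite loc_mapE; apply: frac_eq; rewrite rmorph1.
Qed.

(** [A] is local, so localizing it at its maximal ideal changes nothing. *)
Lemma stalk_map_closed_point : bijective (stalk_map t closed_point).
Proof.
set y := closed_point.
have [q _ qx] := chart_mem c; have AL := canonical_mor_localization qx.
have Uy : chart_open c (t y) by exists (spec_comap phi y).
(* The points [t y] and [x] are equal, but their stalks are distinct types; both are compared with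
   the chart ring. *)
have gL := germ_at_localization Uy (erefl (t y)).
have mP := max_idealP x; have [num eq0 unit] := AL.
have nphi b : ~ q b -> ~ y (phi b) by move=> nb /(loc_max_comap AL mP).
have inj : injective (stalk_map t y).
  apply: raddf_inj => z e; have [gnum _ gunit] := gL.
  have [a [b [nb zE]]] := gnum z.
  suff ga : germ_at Uy a = 0.
    have [w wE] := gunit b nb.
    by rewrite -[z]mulr1 -wE [w * _]mulrC mulrA zE ga mul0r.
  have : spec_germ y (phi a) = 0.
    by rewrite -(stalk_map_germ_at Uy) -zE rmorphM /= e mul0r.
  rewrite -(rmorph0 (spec_germ y)) => /germP [W [h [h' [Wy eW]]]].
  have := congr1 (fun s : spec_sec W => sval s y Wy) eW.
  rewrite /= /pfun_res /= => /fracP [u nu]; rewrite mulr1 mul0r mulr0 => ua.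
  have [w wE] := loc_max_unit AL mP nu.
  have [|v nv va] := eq0 a; first by rewrite -[LHS]mul1r -wE -mulrA ua mulr0.
  have [w' w'E] := gunit v (nphi _ nv).
  by rewrite -[LHS]mul1r -w'E -mulrA -rmorphM va rmorph0 mulr0.
(* Near the closed point a section is a/d with d a unit of [A]; then a/d is itself a fraction a'/b
   from the chart ring, which gives the preimage. *)
have surj z : exists a, stalk_map t y a = z.
  have [U [Uy' [s ->]]] := rgerm_ex z; have [V [h [Vy [a [d sE]]]]] := svalP s y Uy'.
  have nd : ~ y d by have [] := sE y Vy.
  have [w wE] := loc_max_unit AL mP nd; have [a' [b [nb aE]]] := num (w * a).
  have [_ _ gunit] := gL; have [w' w'E] := gunit b (nphi _ nb).
  have sd : rgerm Uy' s * spec_germ y d = spec_germ y a.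
    have hV : V `<=` opensT (spec A) by [].
    rewrite /spec_germ /= -!(@rgerm_res _ 'O_(Spec_of A) y _ _ hV I Vy).
    rewrite -(rgerm_res h Uy' Vy) -rmorphM; congr (rgerm _ _).
    apply: locsec_eq => p Vp; have [np] := sE p Vp; rewrite /= => ->.
    by rewrite /pfun_res /= frac_mul; apply: frac_eq; rewrite !mulr1 mulrC.
  have sE' : rgerm Uy' s = spec_germ y (w * a).
    by rewrite rmorphM -sd mulrCA -(rmorphM (spec_germ y)) wE rmorph1 mulr1.
  exists (w' * germ_at Uy a'); rewrite rmorphM /= stalk_map_germ_at -aE rmorphM -sE'.
  by rewrite -(stalk_map_germ_at Uy) mulrCA -(rmorphM (stalk_map t y)) w'E
    rmorph1 mulr1.
pose g z := projT1 (cid (surj z)).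
have Kg : cancel g (stalk_map t y) by move=> z; exact: projT2 (cid (surj z)).
by exists g => // z; apply: inj; rewrite Kg.
Qed.

Variable F : modSheaf 'O_X.

(** Evaluate the unit at the closed point, where the stalk map is bijective and the tensor with 1
    loses nothing. *)
Lemma ker_adj_unit_germ (U : opens X) (s : F U) (Ux : U x) :
  ker (adj_unit t F) U s -> mgerm Ux s = 0.
Proof.
have tx := canonical_mor_closed_point; move=> e.
have Uy : U (t closed_point) by rewrite tx.
have /(pure_tensor_eq0 stalk_map_closed_point) /mgerm_eq0 [W [h [Wy sW]]] :=
  congr1 (fun u : inv_sec t F (opens_preim (mcont t) U) => sval u closed_point Uy) e.
by apply/mgerm_eq0; exists W, h; split=> //; rewrite -[X in W X]tx.
Qed.

(** The values of the unit on [s] are tensors of germs of [s] at points of the image of [t], all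
    generizations of [x]. *)
Lemma ker_adj_unit_generic (U : opens X) (s : F U) :
  (forall y (Uy : U y), closure [set y] x -> mgerm Uy s = 0) -> ker (adj_unit t F) U s.
Proof.
move=> e; apply: locsec_eq => y Uy /=; rewrite /unit_pfun e; last first.
  exact: canonical_mor_generic.
by rewrite -[X in pure_tensor _ X](scale0r 0) pure_tensorZl rmorph0 mul0r
  -[X in pure_tensor _ _ X](mul0r 0) -pure_tensorZ scale0r.
Qed.

End CanonicalMorphism.

(** * Splitting a section along two disjoint closed sets *)

Definition opensD (X : topologicalType) (U : opens X) (A : set X) (Ac : closed A) :
  opens X := Opens (openI (opensP U) (closed_openC Ac)).

Lemma section_supported_part (X : topologicalType) (O : ringSheaf X) (F : modSheaf O)
    (A B : set X) (U : opens X) (s : F U) :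
  closed A -> closed B -> A `&` B = set0 ->
  (forall x (Ux : U x), mgerm Ux s <> 0 -> A x \/ B x) ->
  exists t : F U, forall x (Ux : U x),
    (A x -> mgerm Ux t = mgerm Ux s) /\ (~ A x -> mgerm Ux t = 0).
Proof.
move=> Ac Bc AB0 supp.
(* Glue [s] off [B] ([true]) with 0 off [A] ([false]): these opens cover [U] by disjointness, and
   [s] vanishes on their overlap. *)
pose V (b : bool) := if b then opensD U Bc else opensD U Ac.
have hV b : V b `<=` U by case: b => x [].
pose r b : F (V b) := if b then mres F (hV b) s else 0.
have nAB x : A x -> B x -> False.
  by move=> Ax Bx; have : (A `&` B) x by []; rewrite AB0.
have off (W : opens X) (h : W `<=` U) : W `<=` ~` A -> W `<=` ~` B -> mres F h s = 0.
  move=> WA WB; apply: mgerm_sep => x Wx; rewrite raddf0 (mgerm_res h (h x Wx)).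
  by apply: contrapT => /supp [/(WA x Wx)|/(WB x Wx)].
have [| |t tE] := @sheaf_glue _ _ _ (modSheafP F) U bool V hV r.
- move=> x Ux; have [Bx|nBx] := pselect (B x); last by exists true.
  by exists false; split=> // Ax; exact: nAB Ax Bx.
- move=> i j W hi hj.
  case: i hi => hi; case: j hj => hj; rewrite /r.
  + by congr (mres F _ _).
  + rewrite raddf0 (sheaf_comp (modSheafP F) _ _ (subset_trans hi (hV _))).
    by apply: off => x Wx; [case: (hj x Wx)|case: (hi x Wx)].
  + rewrite raddf0 (sheaf_comp (modSheafP F) _ _ (subset_trans hj (hV _))).
    by apply/esym/off => x Wx; [case: (hi x Wx)|case: (hj x Wx)].
  + by rewrite !raddf0.
exists t => x Ux; split=> [Ax|nAx].
  have Vx : V true x by split=> // /(nAB x Ax).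
  by rewrite -(mgerm_res (hV true) Ux Vx) tE /r (mgerm_res (hV true) Ux Vx).
have Vx : V false x by [].
by rewrite -(mgerm_res (hV false) Ux Vx) tE /r raddf0.
Qed.

(** * The decomposition of [F] *)

Theorem theorem1p3 (X : scheme) (F : modSheaf 'O_X) (n : nat) (p : 'I_n -> X)
    (X_noetherian : noetherian_scheme X)
    (F_coherent : coherent F)
    (F_nonzero : exists (U : opens X) (s : F U), s <> 0)
    (p_inj : injective p)
    (p_Ass : Ass F = range p)
    (p_disj : forall i j, i != j -> closure [set p i] `&` closure [set p j] = set0) :
  let Fi (i : 'I_n) : submod F :=
    submod_bigcap (fun j : 'I_n => j != i)
      (fun j => ker (adj_unit (canonical_mor (p j)) F)) in
  (forall i, Ass (Fi i) = [set p i]) /\ internal_direct_sum Fi.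
Proof.
move=> Fi; pose Z i := closure [set p i].
have Zclosed i : closed (Z i) by exact: closed_closure.
have Zp i : Z i (p i) by exact: subset_closure.
have Zdisj x i j : Z i x -> Z j x -> i = j.
  move=> ix jx; apply: contrapT => /eqP /p_disj ij.
  by have : (closure [set p i] `&` closure [set p j]) x by []; rewrite ij.
have Zgen i x y : Z i x -> closure [set x] y -> Z i y.
  move=> /closure1P ix /closure1P xy; apply/closure1P => U /xy; exact: ix.
have supp (U : opens X) (s : F U) x (Ux : U x) : mgerm Ux s <> 0 ->
    exists i, Z i x /\ exists Up : U (p i), mgerm Up s <> 0.
  move=> /(support_Ass X_noetherian.1 F_coherent.2) [y [Ay xy [Uy sy]]].
  move: Ay; rewrite p_Ass => -[i _ iy]; exists i.
  by rewrite -iy in xy Uy sy *; split=> //; exists Uy.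
(* A nonzero germ at [x] gives a nonzero germ at some [p j] specializing to [x]; the kernel
   condition excludes j other than i. *)
have Fi_supp i (U : opens X) (s : F U) x (Ux : U x) :
    Fi i U s -> mgerm Ux s <> 0 -> Z i x.
  move=> Fs /supp [j [jx [Up sp]]]; have [<- //|/eqP ji] := pselect (j = i).
  by case: sp; apply: ker_adj_unit_germ; exact: Fs.
have Fi_zero i (U : opens X) (s : F U) x (Ux : U x) :
    Fi i U s -> ~ Z i x -> mgerm Ux s = 0.
  by move=> Fs nix; apply: contrapT => /(Fi_supp i _ _ _ _ Fs).
have part i (U : opens X) (s : F U) : exists t : F U,
    Fi i U t /\ forall x (Ux : U x), Z i x -> mgerm Ux t = mgerm Ux s.
  pose B := \bigcup_(j in [set j | j != i]) Z j.
  have Bclosed : closed B.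
    by apply: closed_bigcup => // ; exact: cardinality.finite_finset.
  have ZB : Z i `&` B = set0.
    by apply/seteqP; split=> // x [ix [j /= ji jx]]; rewrite (Zdisj x j i) ?eqxx in ji.
  have [x Ux /supp [j [jx _]]|t tE] :=
      section_supported_part (Zclosed i) Bclosed ZB (s := s).
    by have [<-|/eqP ji] := pselect (j = i); [left|right; exists j].
  exists t; split=> [j ji|x Ux]; last by case: (tE x Ux).
  (* A generization [y] of [p j] lies off [Z i], as otherwise [p j] would lie in [Z i]; hence [t]
     vanishes there. *)
  apply: ker_adj_unit_generic => y Uy yj; case: (tE y Uy) => _; apply=> iy.
  by rewrite (Zdisj (p j) j i) ?eqxx // in ji; exact: Zgen iy yj.
split=> [i|U s].
  apply/seteqP; split=> [x [z]|_ ->].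
    have [U [Ux [s ->]]] := mgerm_ex z; rewrite annihilator_sub => sx.
    have : Ass F x by exists (mgerm Ux (sval s)).
    rewrite p_Ass => -[j _ jx]; rewrite -jx; congr p.
    (* A germ whose annihilator is the maximal ideal is nonzero, so [x] lies in the support
       [Z i]. *)
    apply: Zdisj (Zp j) _; rewrite jx; apply: Fi_supp (svalP s) _ => s0.
    have [_ m1 _] := max_idealP x; apply: m1; rewrite -sx s0.
    by rewrite /annihilator /= scaler0.
  have : Ass F (p i) by rewrite p_Ass; exists i.
  move=> [z]; have [U [Up [s ->]]] := mgerm_ex z => sp.
  (* Replacing [s] by its part in [Fi i] keeps the germ at [p i], hence the annihilator. *)
  have [t [ti tE]] := part i U s.
  exists (@mgerm _ _ (Fi i) _ U Up (exist _ t ti)).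
  by rewrite annihilator_sub /= tE.
have [t tE] := choice (fun i => part i U s).
have sum_germ (u : {ffun 'I_n -> F U}) i x (Ux : U x) :
    (forall j, Fi j U (u j)) -> Z i x -> mgerm Ux (\sum_j u j) = mgerm Ux (u i).
  move=> uF ix; rewrite raddf_sum; apply: big_only1 => // j ji _.
  apply: Fi_zero (uF j) _ => jx.
  by rewrite (Zdisj x j i) ?eqxx in ji.
exists [ffun i => t i]; split.
  have tF j : Fi j U ([ffun i => t i] j) by rewrite ffunE; case: (tE j).
  split=> //; apply: mgerm_sep => x Ux.
  have [[i ix]|nx] := pselect (exists i, Z i x).
    by rewrite (sum_germ _ i) // ffunE; case: (tE i) => _ ->.
  rewrite raddf_sum big1 => [|j _].
    by apply: contrapT => /supp [i [ix _]]; apply: nx; exists i.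
  by apply: Fi_zero (tF j) _ => jx; apply: nx; exists j.
(* Uniqueness: the germs of the i-th component are those of [s] on [Z i] and zero elsewhere. *)
move=> u [uF sE]; apply/ffunP => i; rewrite ffunE; apply: mgerm_sep => x Ux.
have [ti te] := tE i; have [ix|nix] := pselect (Z i x).
  by rewrite te // sE (sum_germ _ i).
by rewrite (Fi_zero _ _ _ _ _ ti nix) (Fi_zero _ _ _ _ _ (uF i) nix).
Qed.
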